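(* Let $l\ge0$, $N\ge1$, let $\mu=(\mu_1,\dots,\mu_l)$ and $\lambda=(\lambda_1,\dots,\lambda_{l+N})$ be generalized partitions, and let $\{x^{\pm}\}=\{x_1,x_1^{-1},\dots,x_N,x_N^{-1}\}$. Then $$\langle\mu^{\rm o}|\Gamma_+(\{x^{\pm}\})|\lambda^{\rm o}\rangle=\det(b_{ij})_{i,j=1}^{l+N},$$ where $$b_{ij}=\begin{cases}h_{\lambda_i-\mu_j-i+j}(x^{\pm}), & 1\le j\le l,\\ h_{\lambda_i-i+j}(x^{\pm})-h_{\lambda_i-i-j+2l}(x^{\pm}), & l+1\le j\le l+N.\end{cases}$$
   Context: A generalized partition $\lambda=(\lambda_1,\dots,\lambda_n)$ is a finite weakly decreasing sequence of nonnegative integers (zeros allowed; the number $n$ of entries is part of the data). Fock spaces. Let $\mathcal H$ be the Heisenberg algebra generated by $a_n$ ($n\in\mathbb Z\setminus\{0\}$) with $[a_m,a_n]=m\delta_{m,-n}$. Let $\mathcal M$ be the left $\mathcal H$-module generated by $|0\rangle$ with $a_n|0\rangle=0$ for $n>0$ (so $\mathcal M\cong\mathbb C[a_{-1},a_{-2},\dots]$), and $\mathcal M^*$ the right $\mathcal H$-module generated by $\langle 0|$ with $\langle 0|a_{-n}=0$ for $n>0$ (so $\mathcal M^*\cong\mathbb C[a_1,a_2,\dots]$, graded by $\deg a_n=n$), with completion $\widetilde{\mathcal M^*}$ with respect to the filtration by subspaces spanned by homogeneous elements of degree $\ge n$. The pairing of $\langle u|\in\widetilde{\mathcal M^*}$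 and $|v\rangle\in\mathcal M$ is determined by $\langle0|0\rangle=1$ and $\langle uA|v\rangle=\langle u|Av\rangle$; $\langle u|A|v\rangle$ denotes this common value. Vertex operators (formal series in $z$): $W(z)=(1-z^2)\exp\big(\sum_{n\ge1}\frac{a_{-n}}{n}z^n\big)\exp\big(-\sum_{n\ge1}\frac{a_n}{n}(z^{-n}+z^n)\big)=\sum_{n\in\mathbb Z}W_nz^{-n}$, $W^*(z)=\exp\big(-\sum_{n\ge1}\frac{a_{-n}}{n}z^n\big)\exp\big(\sum_{n\ge1}\frac{a_n}{n}(z^{-n}+z^n)\big)=\sum_{n\in\mathbb Z}W^*_nz^{n}$. For a generalized partition $\nu=(\nu_1,\dots,\nu_n)$: $|\nu^{\rm o}\rangle=W_{-\nu_1}\cdots W_{-\nu_n}|0\rangle$ and $\langle\nu^{\rm o}|=\langle0|W^*_{-\nu_n}\cdots W^*_{-\nu_1}\in\widetilde{\mathcal M^*}$. $\Gamma_+(z)=\exp\big(\sum_{n\ge1}\frac{a_n}{n}z^n\big)$ and $\Gamma_+(\{x^{\pm}\})=\prod_{i=1}^N\Gamma_+(x_i)\Gamma_+(x_i^{-1})$. $h_n(x^{\pm})$ is defined by $\prod_{i=1}^N\frac{1}{(1-x_iz)(1-x_i^{-1}z)}=\sum_{n\in\mathbb Z}h_n(x^{\pm})z^n$ (expanded in nonnegative powers of $z$), so $h_n(x^\pm)=0$ for $n<0$. *)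

(* Defs.v *)
From HB Require Import structures.
From mathcomp Require Import all_boot all_order all_algebra finmap.
From mathcomp Require Import boolp classical_sets functions cardinality fsbigop.
From mathcomp.multinomials Require Import monalg.

Set Implicit Arguments.
Unset Strict Implicit.
Unset Printing Implicit Defensive.

Import GRing.Theory.

Local Open Scope classical_set_scope.
Local Open Scope ring_scope.

(* The ground field F (C in the source) is used below in characteristic 0.    *)
(* Monomials in the Heisenberg generators are {cmonom nat}: the variable of   *)
(* index i stands for a_{-(i+1)} in the Fock space and for a_{i+1} in its     *)
(* dual.                                                                      *)

(* M = F[a_{-1}, a_{-2}, ...], with |0> the unit monomial. *)
Definition fock (F : fieldType) := {malg F[{cmonom nat}]}.

(* The completion of M^* = F[a_1, a_2, ...] along the degree filtration is    *)
(* the product of its homogeneous components.  Each of those has a finite     *)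
(* monomial basis, so an element of the completion is an arbitrary family of  *)
(* coefficients indexed by monomials.                                         *)
Definition dual_fock (F : fieldType) := {cmonom nat} -> F^o.

Definition vac {F : fieldType} : fock F := << mone >>.

Definition dual_vac {F : fieldType} : dual_fock F := fun m => (m == mone)%:R.

(* The action of a_k on M from the left; a_{i+1} acts as                      *)
(* (i+1) d/da_{-(i+1)}.  There is no generator a_0: its value is a dummy.     *)
(* It is locked because unification diverges when it unfolds this action.     *)
HB.lock Definition aL {F : fieldType} (k : int) (v : fock F) : fock F :=
  match k with
  | Posz 0 => 0
  | Posz i.+1 =>
      \sum_(m <- msupp v) << (i.+1 * m i)%:R * v@_m *g divcm m (ucm i) >>
  | Negz i => << ucm i >> * v
  end.

(* The action of a_k on the completion of M^* from the right, u |-> u a_k;    *)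
(* a_{-(i+1)} acts as (i+1) d/da_{i+1}.                                       *)
Definition aR {F : fieldType} (k : int) (u : dual_fock F) : dual_fock F :=
  match k with
  | Posz 0 => 0
  | Posz i.+1 => fun m => if m i == 0%N then 0 else u (divcm m (ucm i))
  | Negz i => fun m => (i.+1 * (m i).+1)%:R * u (mulcm m (ucm i))
  end.

(* <a^m | a^m'> is 0 unless m = m', and <a^m | a^m> = mono_norm m. *)
Definition mono_norm {F : fieldType} (m : {cmonom nat}) : F :=
  \prod_(i <- finsupp m) (i.+1 ^ m i * (m i)`!)%:R.

Definition pairing {F : fieldType} (u : dual_fock F) (v : fock F) : F :=
  \sum_(m <- msupp v) v@_m * u m * mono_norm m.

(* Infinite sums are sums of families with finitely many nonzero terms in the *)
(* Fock space, and are taken pointwise in spaces of functions: monomial by    *)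
(* monomial in dual_fock, and coefficient by coefficient for formal series    *)
(* in z.  All the sums occurring in kets and bras have finite support in this *)
(* sense.                                                                     *)
Definition fsum {V : nmodType} (f : nat -> V) : V :=
  \sum_(i \in [set: nat]) f i.

Definition pwsum {T V : Type} (S : (nat -> V) -> V) (f : nat -> T -> V) :
  T -> V := fun t => S (fun i => f i t).

(* exp(X) v = \sum_j X^j v / j! *)
Definition opexp {F : fieldType} {V : lmodType F} (S : (nat -> V) -> V)
    (X : V -> V) (v : V) : V :=
  S (fun j => (j`!%:R : F)^-1 *: iter j X v).

Section VertexExponentials.

Context {F : fieldType} {V : lmodType F}.

(* S is the summation of V; a k is the action of a_k on V. *)
Variables (S : (nat -> V) -> V) (a : int -> V -> V).

(* A formal series f(z) = \sum_k f_k z^k with k ranging over all the integers *)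
(* is the function k |-> f_k.                                                 *)
Definition const_series (v : V) : int -> V := fun k => if k == 0 then v else 0.

(* exp(c \sum_(n >= 1) a_{-n} / n z^n) f(z), with n = i + 1 *)
Definition exp_creation (c : F) : (int -> V) -> int -> V :=
  opexp (pwsum S) (fun f k =>
    S (fun i => (c / i.+1%:R) *: a (- i.+1%:Z) (f (k - i.+1%:Z)))).

(* exp(c \sum_(n >= 1) a_n / n (z^{-n} + z^n)) f(z), with n = i + 1 *)
Definition exp_annihilation (c : F) : (int -> V) -> int -> V :=
  opexp (pwsum S) (fun f k =>
    S (fun i => (c / i.+1%:R) *: a i.+1%:Z (f (k + i.+1%:Z) + f (k - i.+1%:Z)))).

End VertexExponentials.

(* W_n v is the coefficient of z^{-n} in W(z) v. *)
Definition W {F : fieldType} (n : int) (v : fock F) : fock F :=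
  let f := exp_creation fsum aL 1
             (exp_annihilation fsum aL (- 1) (const_series v)) in
  f (- n) - f (- n - 2).

(* u W^*_n is the coefficient of z^n in u W^*(z).  For a right action the     *)
(* leftmost factor of W^*(z) is applied first.                                *)
Definition Wstar {F : fieldType} (n : int) (u : dual_fock F) : dual_fock F :=
  exp_annihilation (pwsum fsum) aR 1
    (exp_creation (pwsum fsum) aR (- 1) (const_series u)) n.

(* |nu^o> = W_{-nu_1} ... W_{-nu_n} |0> *)
Definition ket {F : fieldType} (nu : seq nat) : fock F :=
  foldr (fun k v => W (- k%:Z) v) vac nu.

(* <nu^o| = <0| W^*_{-nu_n} ... W^*_{-nu_1} *)
Definition bra {F : fieldType} (nu : seq nat) : dual_fock F :=
  foldr (fun k u => Wstar (- k%:Z) u) dual_vac nu.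

(* Gamma_+(t) = exp(\sum_(n >= 1) a_n / n t^n) acting on M, with n = i + 1 *)
Definition Gamma_plus {F : fieldType} (t : F) : fock F -> fock F :=
  opexp fsum (fun v => fsum (fun i => (t ^+ i.+1 / i.+1%:R) *: aL i.+1%:Z v)).

Definition Gamma_plus_pm {F : fieldType} {N : nat} (x : 'I_N -> F)
    (v : fock F) : fock F :=
  foldr (fun i w => Gamma_plus (x i) (Gamma_plus (x i)^-1 w)) v (enum 'I_N).

(* h_n(x^{+-}) is the coefficient of z^n in the product of the geometric      *)
(* series 1/(1 - x_i z) and 1/(1 - x_i^{-1} z), which only involves their     *)
(* terms of degree at most n.                                                 *)
Definition h_pm {F : fieldType} {N : nat} (x : 'I_N -> F) (n : int) : F :=
  match n with
  | Posz n =>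
      (\prod_(i < N) ((\poly_(k < n.+1) x i ^+ k) *
                      (\poly_(k < n.+1) (x i)^-1 ^+ k)))`_n
  | Negz _ => 0
  end.

(* Indices start at 0 here, so that i.+1 and j.+1 are the row and column      *)
(* numbers of the source.                                                     *)
Definition b_mx {F : fieldType} {l N : nat} (x : 'I_N -> F)
    (mu : l.-tuple nat) (lam : (l + N).-tuple nat) : 'M[F]_(l + N) :=
  \matrix_(i < l + N, j < l + N)
    match fintype.split j with
    | inl j' =>
        h_pm x ((tnth lam i)%:Z - (tnth mu j')%:Z - i.+1%:Z + j.+1%:Z)
    | inr _ =>
        h_pm x ((tnth lam i)%:Z - i.+1%:Z + j.+1%:Z) -
        h_pm x ((tnth lam i)%:Z - i.+1%:Z - j.+1%:Z + (2 * l)%:Z)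
    end.

(* The remaining lemmas check that fock, dual_fock and pairing satisfy the    *)
(* properties that determine them: the Heisenberg relations, the vacuum       *)
(* conditions, <0|0> = 1 and <u a_k | v> = <u | a_k v>; and that h_pm is the  *)
(* inverse of \prod_i (1 - x_i z)(1 - x_i^{-1} z).                            *)
Section Facts.

Variable F : fieldType.
Implicit Types (u : dual_fock F) (v w : fock F) (m : {cmonom nat}).

Lemma divcmK i m : m i != 0%N -> mulcm (divcm m (ucm i)) (ucm i) = m.
Proof.
move=> mi; apply/eqP/cmP => j; rewrite mulcmE divcmE ucmE.
by case: eqP => [<-|_] /=; [rewrite subnK ?lt0n | rewrite subn0 addn0].
Qed.

Lemma mulcmK i m : divcm (mulcm m (ucm i)) (ucm i) = m.
Proof. by apply/eqP/cmP => j; rewrite divcmE mulcmE addnK. Qed.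

Lemma big_msupp v m0 (c : {cmonom nat} -> F) :
  \sum_(m <- msupp v) c m * v@_m *+ (m == m0) = c m0 * v@_m0.
Proof.
have [m0v|m0v] := boolP (m0 \in msupp v).
  rewrite (bigD1_seq m0) ?fset_uniq //= eqxx mulr1n big1 ?addr0 // => m /negPf->.
  by rewrite mulr0n.
rewrite (mcoeff_outdom m0v) mulr0 big_seq big1 // => m mv.
by case: eqP => [mm0|]; [rewrite mm0 (negPf m0v) in mv | rewrite mulr0n].
Qed.

Lemma aL_posE i v m :
  (aL (Posz i.+1) v)@_m = (i.+1 * (m i).+1)%:R * v@_(mulcm m (ucm i)).
Proof.
have -> : (i.+1 * (m i).+1 = i.+1 * mulcm m (ucm i) i)%N.
  by rewrite mulcmE ucmE eqxx addn1.
rewrite aL.unlock /= raddf_sum /= -(big_msupp v _ (fun m' => (i.+1 * m' i)%:R)).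
apply: eq_bigr => m' _; rewrite mcoeffU.
have [m'i|m'i] := eqVneq (m' i) 0%N; first by rewrite m'i muln0 !mul0r !mul0rn.
congr (_ *+ nat_of_bool _); apply/eqP/eqP => [<-|->].
  by rewrite divcmK.
by rewrite mulcmK.
Qed.

Lemma aL_negE i v m :
  (aL (Negz i) v)@_m = if m i == 0%N then 0 else v@_(divcm m (ucm i)).
Proof.
rewrite aL.unlock /= mcoeffMl msuppU1 big_seq_fset1.
under eq_bigr => m' _ do rewrite mcoeffU1 eqxx mul1r.
case: ifP => [/eqP mi|/negbT mi].
  apply: big1 => m' _; case: eqP => // /eqP/cmP/(_ i).
  by rewrite mulcmE ucmE eqxx mi.
rewrite -[RHS]mul1r -(big_msupp v _ (fun=> 1)); apply: eq_bigr => m' _.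
rewrite mul1r; congr (_ *+ nat_of_bool _); apply/eqP/eqP => [<-|->].
  by rewrite [mmul _ _]mulcmC mulcmK.
by rewrite [mmul _ _]mulcmC divcmK.
Qed.

Lemma mcoeff_lin c v w m : (c *: v + w)@_m = c * v@_m + w@_m.
Proof. by rewrite mcoeffD mcoeffZ. Qed.

Lemma aL_linear k c v w : aL k (c *: v + w) = c *: aL k v + aL k w.
Proof.
case: k => [[|i]|i]; last by rewrite aL.unlock mulrDr scalerAr.
  by rewrite aL.unlock scaler0 addr0.
by apply/malgP => m; rewrite mcoeff_lin !aL_posE mcoeff_lin mulrDr mulrCA.
Qed.

Lemma mulcmAC i j m :
  mulcm (mulcm m (ucm i)) (ucm j) = mulcm (mulcm m (ucm j)) (ucm i).
Proof. by apply/eqP/cmP => t; rewrite !mulcmE addnAC. Qed.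

Lemma divcmAC i j m :
  divcm (divcm m (ucm i)) (ucm j) = divcm (divcm m (ucm j)) (ucm i).
Proof. by apply/eqP/cmP => t; rewrite !divcmE subnAC. Qed.

Lemma mul_divcm i j m : i != j ->
  mulcm (divcm m (ucm i)) (ucm j) = divcm (mulcm m (ucm j)) (ucm i).
Proof.
move=> /negPf ij; apply/eqP/cmP => t; rewrite !(divcmE, mulcmE) !ucmE.
case: (eqVneq i t) ij => [-> ij|_ _]; last by rewrite !subn0.
by rewrite eq_sym ij !addn0.
Qed.

Lemma aL_posC i j v :
  aL (Posz i.+1) (aL (Posz j.+1) v) = aL (Posz j.+1) (aL (Posz i.+1) v).
Proof.
apply/malgP => m; rewrite !aL_posE !mulrA -!natrM mulcmAC !mulcmE !ucmE.
have [->//|ij] := eqVneq i j; rewrite !addn0; congr (_%:R * _).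
by rewrite mulnC.
Qed.

Lemma aL_negC i j v :
  aL (Negz i) (aL (Negz j) v) = aL (Negz j) (aL (Negz i) v).
Proof.
apply/malgP => m; rewrite !aL_negE divcmAC !divcmE !ucmE.
have [->//|ij] := eqVneq i j; rewrite !subn0.
by case: (m i == 0%N); case: (m j == 0%N).
Qed.

Lemma aL_pos_neg i j v :
  aL (Posz i.+1) (aL (Negz j) v) =
  aL (Negz j) (aL (Posz i.+1) v) + (if i == j then i.+1%:R *: v else 0).
Proof.
apply/malgP => m; rewrite mcoeffD aL_posE !aL_negE aL_posE mulcmE ucmE.
have [<-|ij] := eqVneq i j; last first.
  rewrite mcoeff0 !addr0 addn0; case: ifP => [_|_]; first by rewrite mulr0.
  by rewrite divcmE ucmE [j == i]eq_sym (negPf ij) subn0 mul_divcm // eq_sym.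
rewrite addn1 /= mulcmK mcoeffZ; case: (posnP (m i)) => [->|mi].
  by rewrite muln1 add0r.
rewrite divcmE ucmE eqxx subn1 prednK // divcmK ?gtn_eqF ?(gt_eqF mi) -?lt0n //.
by rewrite -mulrDl -natrD addnC mulnS.
Qed.

Lemma heisenberg_left (m n : int) v : m != 0 -> n != 0 ->
  aL m (aL n v) - aL n (aL m v) = (if m == - n then m%:~R else 0) *: v.
Proof.
case: m n => [[|i]|i] [[|j]|j] // _ _.
- by rewrite aL_posC subrr scale0r.
- rewrite aL_pos_neg NegzE opprK addrC addKr eqz_nat eqSS.
  by case: eqP; rewrite ?scale0r.
- rewrite aL_pos_neg opprD addrA subrr sub0r NegzE eqr_opp eqz_nat eqSS eq_sym.
  by case: eqP => [->|_]; rewrite ?scale0r ?oppr0 // mulrNz scaleNr.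
- by rewrite aL_negC subrr scale0r.
Qed.

Lemma aR_neg_pos i j u :
  aR (Negz j) (aR (Posz i.+1) u) =
  aR (Posz i.+1) (aR (Negz j) u) + (if i == j then i.+1%:R *: u else 0).
Proof.
apply/funext => m.
rewrite -[RHS]/(aR i.+1 (aR (Negz j) u) m +
                (if i == j then i.+1%:R *: u else 0) m) /= mulcmE ucmE.
have [<-|ij] := eqVneq i j; last first.
  rewrite addn0 addr0.
  case: ifP => _; first by rewrite mulr0.
  by rewrite divcmE ucmE (negPf ij) subn0 mul_divcm.
rewrite addn1 /= mulcmK; case: (posnP (m i)) => [->|mi].
  by rewrite muln1 add0r.
rewrite divcmE ucmE eqxx subn1 prednK // divcmK -?lt0n //.
by rewrite -[(_ *: _) m]/(i.+1%:R * u m) -mulrDl -natrD addnC mulnS.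
Qed.

Lemma heisenberg_right (m n : int) u : m != 0 -> n != 0 ->
  aR n (aR m u) - aR m (aR n u) = (if m == - n then m%:~R else 0) *: u.
Proof.
case: m n => [[|i]|i] [[|j]|j] // _ _.
- apply/eqP; rewrite scale0r subr_eq0; apply/eqP/funext => m /=.
  rewrite !divcmE !ucmE divcmAC [j == i]eq_sym.
  have [->//|ij] := eqVneq i j; rewrite !subn0.
  by case: (m i == 0%N); case: (m j == 0%N).
- rewrite aR_neg_pos NegzE opprK addrC addKr eqz_nat eqSS.
  by case: eqP; rewrite ?scale0r.
- rewrite aR_neg_pos opprD addrA subrr sub0r NegzE eqr_opp eqz_nat eqSS eq_sym.
  by case: eqP => [->|_]; rewrite ?scale0r ?oppr0 // mulrNz scaleNr.
- apply/eqP; rewrite scale0r subr_eq0; apply/eqP/funext => m /=.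
  rewrite !mulrA -!natrM mulcmAC !mulcmE !ucmE [j == i]eq_sym.
  have [->//|ij] := eqVneq i j; rewrite !addn0; congr (_%:R * _).
  by rewrite mulnC.
Qed.

Lemma aL_vac i : aL (Posz i.+1) (vac : fock F) = 0.
Proof.
apply/malgP => m; rewrite aL_posE mcoeff0 mcoeffU1.
case: eqP => [/eqP/cmP/(_ i)|_]; last by rewrite mulr0.
by rewrite cm1 mulcmE ucmE eqxx addn1.
Qed.

Lemma aR_vac i : aR (Negz i) (dual_vac : dual_fock F) = 0.
Proof.
apply/funext => m; rewrite /= /dual_vac.
case: eqP => [/eqP/cmP/(_ i)|_]; last by rewrite mulr0.
by rewrite cm1 mulcmE ucmE eqxx addn1.
Qed.

Lemma mono_norm_mul i m :
  mono_norm (mulcm m (ucm i)) = (i.+1 * (m i).+1)%:R * mono_norm m :> F.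
Proof.
pose d := (finsupp m `|` [fset i])%fset.
have normE m' : (finsupp m' `<=` d)%fset ->
    mono_norm m' = \prod_(t <- d) (t.+1 ^ m' t * (m' t)`!)%:R :> F.
  move=> m'd; apply: big_fset_incl => // t _; rewrite -cmE_eq0 => /eqP ->.
  by rewrite expn0.
have di : i \in d by rewrite !inE eqxx orbT.
rewrite !normE /d ?mdomD ?mdomU ?fsubsetUl // !(big_fsetD1 i di) /= mulrA.
congr (_ * _); last first.
  rewrite big_seq [RHS]big_seq; apply: eq_bigr => t.
  by rewrite !inE mulcmE ucmE => /andP[/negPf ti _]; rewrite eq_sym ti addn0.
by rewrite mulcmE ucmE eqxx addn1 expnS factS -natrM mulnACA.
Qed.

Lemma pairingU u c m : pairing u << c *g m >> = c * u m * mono_norm m.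
Proof.
rewrite /pairing msuppU; case: eqP => [->|_].
  by rewrite big_seq_fset0 !mul0r.
by rewrite big_seq_fset1 mcoeffUU.
Qed.

Lemma pairing_linear u c v w :
  pairing u (c *: v + w) = c * pairing u v + pairing u w.
Proof.
pose d := (msupp v `|` msupp w `|` msupp (c *: v + w)%R)%fset.
have pE w' : (msupp w' `<=` d)%fset ->
    pairing u w' = \sum_(m <- d) w'@_m * u m * mono_norm m.
  move=> w'd; apply: big_fset_incl => // m _ /mcoeff_outdom ->.
  by rewrite !mul0r.
rewrite !pE /d ?fsubsetUr // -?fsetUA ?fsubsetUl //; last first.
  by rewrite fsetUCA fsubsetUl.
rewrite mulr_sumr -big_split /=; apply: eq_bigr => m _.
by rewrite mcoeff_lin !mulrDl !mulrA.
Qed.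

Lemma pairing_vac : pairing dual_vac vac = 1 :> F.
Proof.
rewrite pairingU /dual_vac eqxx mul1r mul1r /mono_norm mdom1.
exact: big_seq_fset0.
Qed.

Lemma pairing_aR k u v : pairing (aR k u) v = pairing u (aL k v).
Proof.
have pairing0 u' : pairing u' 0 = 0 by rewrite /pairing msupp0 big_seq_fset0.
have pairingD u' w1 w2 : pairing u' (w1 + w2) = pairing u' w1 + pairing u' w2.
  by rewrite -[w1]scale1r pairing_linear mul1r scale1r.
have aLD w1 w2 : aL k (w1 + w2) = aL k w1 + aL k w2 :> fock F.
  by rewrite -[w1]scale1r aL_linear !scale1r.
have aL0 : aL k 0 = 0 :> fock F.
  by have := aL_linear k (- 1) 0 0; rewrite scaler0 addr0 scaleN1r addNr.
rewrite (monalgE v); elim: (X in \sum_(m <- X) _) => [|m s IH].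
  by rewrite big_nil aL0 !pairing0.
rewrite big_cons aLD !pairingD IH; congr (_ + _); move: v@_m => {s IH v} c.
case: k {aLD aL0} => [[|i]|i].
- by rewrite aL.unlock pairing0 pairingU (_ : aR 0 u m = 0) // mulr0 mul0r.
- have -> : aL i.+1 << c *g m >> =
            << (i.+1 * m i)%:R * c *g divcm m (ucm i) >> :> fock F.
    rewrite aL.unlock msuppU; have [->|_] := eqVneq c 0.
      by rewrite big_seq_fset0 mulr0 monalgU0.
    by rewrite big_seq_fset1 mcoeffUU.
  rewrite !pairingU {1}/aR; case: eqP => [->|/eqP mi].
    by rewrite muln0 mulr0 !mul0r.
  have -> : mono_norm m = (i.+1 * m i)%:R * mono_norm (divcm m (ucm i)) :> F.
    rewrite -[in LHS](divcmK mi) mono_norm_mul divcmE ucmE eqxx subn1.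
    by rewrite prednK ?lt0n.
  by rewrite mulrA [_ * _%:R]mulrC !mulrA.
- have -> : aL (Negz i) << c *g m >> = << c *g mulcm m (ucm i) >> :> fock F.
    by rewrite aL.unlock malgM_def fgmulUU mul1r [mmul _ _]mulcmC.
  rewrite !pairingU mono_norm_mul {1}/aR.
  by rewrite [_%:R * u _]mulrC !mulrA.
Qed.

Definition eq_upto (n : nat) (p q : {poly F}) :=
  forall k, (k < n)%N -> p`_k = q`_k.

Lemma eq_uptoM n p q p' q' :
  eq_upto n p q -> eq_upto n p' q' -> eq_upto n (p * p') (q * q').
Proof.
move=> pq pq' k kn; rewrite !coefM; apply: eq_bigr => -[j /= jk] _.
by rewrite pq ?pq' // (leq_ltn_trans _ kn) ?leq_subr // -ltnS.
Qed.

Lemma eq_upto_prod n N (p q : 'I_N -> {poly F}) :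
  (forall i, eq_upto n (p i) (q i)) ->
  eq_upto n (\prod_(i < N) p i) (\prod_(i < N) q i).
Proof. by move=> pq; elim/big_rec2: _ => // i p' q' _; exact: eq_uptoM. Qed.

Lemma eq_upto_geometric n (c : F) :
  eq_upto n ((1 - c *: 'X) * \poly_(k < n) c ^+ k) 1.
Proof.
move=> [|k] kn; rewrite mulrBl mul1r -scalerAl coefB coefZ coefXM coef1 !coef_poly.
  by rewrite kn mulr0 subr0.
by rewrite kn /= ltnW // -exprS subrr.
Qed.

Lemma h_pmE (N : nat) (x : 'I_N -> F) (n : nat) :
  eq_upto n ((\prod_(i < N) ((1 - x i *: 'X) * (1 - (x i)^-1 *: 'X))) *
             \poly_(j < n) h_pm x j) 1.
Proof.
pose geo d (c : F) := \poly_(k < d) c ^+ k.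
pose G d := \prod_(i < N) (geo d (x i) * geo d (x i)^-1).
have geo_trunc d c : (d <= n)%N -> eq_upto d (geo d c) (geo n c).
  by move=> dn k kd; rewrite !coef_poly kd (leq_trans kd dn).
have hG : eq_upto n (\poly_(j < n) h_pm x j) (G n).
  move=> j jn; rewrite coef_poly jn.
  by apply: (@eq_upto_prod j.+1) => // i; apply: eq_uptoM; apply: geo_trunc.
move=> k kn; rewrite (eq_uptoM (fun _ _ => erefl) hG kn) -big_split /=.
rewrite (@eq_upto_prod n N _ (fun=> 1)) ?big1 // => i; rewrite mulrACA.
rewrite -[X in eq_upto _ _ X]mulr1.
by apply: eq_uptoM; exact: eq_upto_geometric.
Qed.

End Facts.

(* Main.v *)
Require Import Defs.
From HB Require Import structures.
From mathcomp Require Import all_boot all_order all_algebra finmap.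
From mathcomp Require Import boolp functions fsbigop.
From mathcomp.multinomials Require Import monalg.
From mathcomp Require Import zify ring.

Set Implicit Arguments.
Unset Strict Implicit.
Unset Printing Implicit Defensive.

Import GRing.Theory.

Local Open Scope ring_scope.

(** The Fock space M is the polynomial ring in the variables a_{-n}.  Put
    H(z) = exp(\sum_n a_{-n} z^n / n) = \sum_m h_m z^m.

    By Taylor's formula, an exponential of annihilation operators acts on M as
    a substitution: Gamma_+(y) sends a_{-n} to a_{-n} + y^n, and
    exp(c \sum_n a_n (z^n + z^{-n}) / n) sends a_{-n} to
    a_{-n} + c (z^n + z^{-n}) (opexp_taylor, Gamma_plusE,
    exp_annihilation_left).  The second substitution depends on z only through
    s = z + z^{-1}, so it is a ring morphism M -> M[s], written laurent_eval c;
    taking the coefficient of a power of z in a product of H(z)^{+-1} with an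
    element of M[s] is a linear form over M that turns multiplication by s into
    a sum of two shifts (laurent_mul).  By adjunction the right operators W^*_n
    are described by the same data (pairing_Wstar).  Newton's identities show
    that laurent_eval (-1) replaces h_m by h_m - s h_{m-1} + h_{m-2}, and that
    laurent_eval 1 inverts this relation (laurent_eval_h, laurent_eval_f).

    For the ket, W(z) applied to det (h_{lambda_i-i+j} - h_{lambda_i-i-j})
    multiplies H(z) by a determinant of three-term combinations of columns.
    Column operations turn it into a determinant with one more row, made of
    rescaled Chebyshev polynomials of the second kind in s, and the coefficient
    extraction in that row yields the new row of the determinant
    (ket_det_step, ket_as_det).  Then Gamma_+ replaces h_m by f_m, where
    \sum_m f_m z^m is H(z) times the generating series of the h_n(x^{+-}).

    For the bra, W^*(w) substitutes in every column of such a determinant; the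
    inverse three-term relation undoes the substitution in all the columns but
    the first.  In that column the coefficient of w^{-k} of H(w)^{-1} times the
    entry loses its dependence on the a_{-n}, because H(w)^{-1} cancels the
    factor H(w) of the series of the f_m: it is the scalar
    h_{M+1-k}(x^{+-}) (Psi_first_column, bra_det_step).  After l steps the first
    l columns are those of the theorem, and the pairing with the vacuum takes
    constant terms in the others (pairing_bra). *)

(** * The Fock space as a polynomial ring *)

(** The variable a_{-(i+1)}.  It is locked, as comparing two elements of the
    Fock space by unfolding them is impracticable. *)
HB.lock Definition creator (F : fieldType) (i : nat) : fock F := << ucm i >>.

Section FockRing.

Variable F : fieldType.
Implicit Types (v w : fock F) (m : {cmonom nat}).

Lemma aL_creator i v : aL (Negz i) v = creator F i * v.
Proof. by rewrite aL.unlock creator.unlock. Qed.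

Lemma aL_pos_creator i j v :
  aL i.+1%:Z (creator F j * v) =
  creator F j * aL i.+1%:Z v + (if i == j then i.+1%:R *: v else 0).
Proof. by rewrite -!aL_creator aL_pos_neg. Qed.

Lemma monom_creator i m : << mulcm m (ucm i) >> = creator F i * << m >> :> fock F.
Proof. by rewrite creator.unlock malgM_def fgmulUU mul1r [mmul _ _]mulcmC. Qed.

Lemma monomZ (c : F) m : << c *g m >> = c *: << m >> :> fock F.
Proof. by apply/malgP => k; rewrite mcoeffZ [in RHS]mcoeffU1 mcoeffU mulr_natr. Qed.

(** Induction on the construction of a polynomial; two linear maps that satisfy
    the same recursion on the variables agree. *)
Lemma fock_ind (P : fock F -> Prop) :
    P 1 -> (forall i v, P v -> P (creator F i * v)) ->
    (forall c v w, P v -> P w -> P (c *: v + w)) ->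
  forall v, P v.
Proof.
move=> P1 Pc PD v.
have P0 : P 0 by have := PD (- 1) 1 1 P1 P1; rewrite scaleN1r addNr.
have Pm m : P << m >>.
  have [n] := ubnP (mdeg m); elim: n m => [m|n IH m].
    by move=> lt0; exfalso; move: lt0; rewrite ltn0.
  have [-> _|m1] := eqVneq m mone; first exact: P1.
  have [i mi] : exists i, m i != 0%N.
    apply: contrapT => mi; move/eqP: m1; apply; apply/eqP/cmP => i.
    by rewrite cm1; apply: contrapT => /eqP ni; apply: mi; exists i.
  rewrite -(divcmK mi) mdegM mdegU addn1 ltnS => lt_n.
  by rewrite monom_creator; apply/Pc/IH.
rewrite (monalgE v); elim: (X in \sum_(m <- X) _) => [|m s IH].
  by rewrite big_nil.
rewrite big_cons; suff -> : << v@_m *g m >> = v@_m *: << m >> by exact: (PD _ _ _ (Pm m) IH).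
exact: monomZ.
Qed.

End FockRing.

Section Evaluation.

Variables (S : comNzRingType) (t : nat -> S).

Definition monom_eval (m : {cmonom nat}) : S :=
  \prod_(i <- finsupp m) t i ^+ m i.

Lemma monom_evalE (d : {fset nat}) (m : {cmonom nat}) :
  (finsupp m `<=` d)%fset -> monom_eval m = \prod_(i <- d) t i ^+ m i.
Proof.
move=> md; apply: big_fset_incl => // i _; rewrite -cmE_eq0 => /eqP ->.
exact: expr0.
Qed.

Lemma monom_eval_mmorphism : mmorphism monom_eval.
Proof.
split=> [m1 m2|]; last by rewrite /monom_eval mdom1 big_seq_fset0.
rewrite (@monom_evalE (finsupp (mulcm m1 m2))) // mdomD.
rewrite (monom_evalE (fsubsetUl _ (finsupp m2))).
rewrite (monom_evalE (fsubsetUr (finsupp m1) _)) -big_split /=.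
by apply: eq_bigr => i _; rewrite cmM exprD.
Qed.

HB.instance Definition _ :=
  isMultiplicative.Build _ _ monom_eval monom_eval_mmorphism.

End Evaluation.

(** The ring morphism sending the i-th variable to t i and extending f. *)
HB.lock Definition fock_eval (F : fieldType) (S : comNzRingType)
    (f : {rmorphism F -> S}) (t : nat -> S) : fock F -> S :=
  mmap f (monom_eval t).

Section EvaluationMorphism.

Variables (F : fieldType) (S : comNzRingType) (f : {rmorphism F -> S}).
Variable t : nat -> S.

Lemma fock_eval_is_zmod_morphism : zmod_morphism (fock_eval f t).
Proof. by rewrite fock_eval.unlock; exact: raddfB. Qed.

Lemma fock_eval_is_monoid_morphism : monoid_morphism (fock_eval f t).
Proof. by rewrite fock_eval.unlock; split; [exact: rmorph1 | exact: rmorphM]. Qed.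

HB.instance Definition _ :=
  GRing.isZmodMorphism.Build (fock F) S (fock_eval f t) fock_eval_is_zmod_morphism.
HB.instance Definition _ :=
  GRing.isMonoidMorphism.Build (fock F) S (fock_eval f t) fock_eval_is_monoid_morphism.

Lemma fock_eval_creator i : fock_eval f t (creator F i) = t i.
Proof.
rewrite creator.unlock fock_eval.unlock mmapU -[LHS]/(f 1 * monom_eval t (ucm i)).
by rewrite rmorph1 mul1r /monom_eval mdomU big_seq_fset1 cmUU.
Qed.

Lemma fock_evalZ c v : fock_eval f t (c *: v) = f c * fock_eval f t v.
Proof. by rewrite fock_eval.unlock; exact: mmapZ. Qed.

End EvaluationMorphism.

(** * Truncated exponentials *)

(** What the sums of the Fock spaces have in common, whether they are taken
    globally or pointwise: a family that vanishes from n on has its finite sum. *)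
Definition summation (V : nmodType) (S : (nat -> V) -> V) :=
  forall f n, (forall i, (n <= i)%N -> f i = 0) -> S f = \sum_(i < n) f i.

Lemma fsum_summation (V : nmodType) : summation (@fsum V).
Proof.
move=> f n f0; rewrite fsbig_ord /fsum; apply/esym/fsbig_widen => // i [_ /= /negP].
by rewrite -leqNgt => /f0.
Qed.

Lemma pwsum_summation (T : Type) (V : nmodType) (S : (nat -> V) -> V) :
  summation S -> summation (@pwsum T V S).
Proof.
move=> sS f n f0; apply/funext => t; rewrite /pwsum (sS _ n) ?fct_sumE //.
by move=> i ni; rewrite f0.
Qed.

Definition char0 (F : fieldType) := forall n, n.+1%:R != 0 :> F.

Lemma char0P (F : fieldType) : [pchar F] =i pred0 -> char0 F.
Proof. by move=> /pcharf0P F0 n; rewrite F0. Qed.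

Lemma fact_neq0 (F : fieldType) j : char0 F -> j`!%:R != 0 :> F.
Proof. by move=> F0; rewrite -[j`!]prednK ?fact_gt0. Qed.

Section TruncatedExponential.

Variables (F : fieldType) (V : lmodType F).
Implicit Types (X A B : V -> V) (v : V).

Definition trunc_exp (n : nat) X v : V :=
  \sum_(j < n) (j`!%:R)^-1 *: iter j X v.

Lemma lin0 (W : lmodType F) (A : V -> W) : linear A -> A 0 = 0.
Proof. by move=> lA; have := lA (- 1) 0 0; rewrite scaler0 addr0 scaleN1r addNr. Qed.

Lemma linD (W : lmodType F) (A : V -> W) : linear A -> {morph A : u v / u + v}.
Proof. by move=> lA u v; rewrite -[u]scale1r lA !scale1r. Qed.

Lemma linZ (W : lmodType F) (A : V -> W) : linear A -> forall c, {morph A : u / c *: u}.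
Proof. by move=> lA c u; rewrite -[c *: u]addr0 lA (lin0 lA) !addr0. Qed.

Lemma lin_sum (W : lmodType F) (A : V -> W) I (r : seq I) (E : I -> V) : linear A ->
  A (\sum_(i <- r) E i) = \sum_(i <- r) A (E i).
Proof. by move=> lA; apply: (big_morph _ (linD lA) (lin0 lA)). Qed.

Lemma iter_linear j X : linear X -> linear (iter j X).
Proof. by move=> lX; elim: j => [|j IH] c u v //; rewrite !iterS IH lX. Qed.

Lemma trunc_exp_linear n X : linear X -> linear (trunc_exp n X).
Proof.
move=> lX c u v; rewrite /trunc_exp scaler_sumr -big_split /=.
apply: eq_bigr => j _; rewrite iter_linear // scalerDr !scalerA.
by rewrite [_ * c]mulrC.
Qed.

Lemma opexp_trunc (S : (nat -> V) -> V) n X v : summation S ->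
  (forall j, (n <= j)%N -> iter j X v = 0) -> opexp S X v = trunc_exp n X v.
Proof. by move=> sS X0; apply: sS => j nj; rewrite X0 // scaler0. Qed.

(** If B = [X, A] commutes with X, then [exp X, A] = B exp X.  The truncation
    order drops by one because X^j A - A X^j = j B X^{j-1}.  The relations are
    only required along the orbit of v. *)
Lemma trunc_exp_comm n X A B v : char0 F ->
    linear X -> linear A -> linear B ->
    (forall j, X (A (iter j X v)) = A (iter j.+1 X v) + B (iter j X v)) ->
    (forall j, X (B (iter j X v)) = B (iter j.+1 X v)) ->
  trunc_exp n.+1 X (A v) = A (trunc_exp n.+1 X v) + B (trunc_exp n X v).
Proof.
move=> F0 lX lA lB XA XB.
have XjA j : iter j X (A v) = A (iter j X v) + j%:R *: B (iter j.-1 X v).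
  elim: j => [|j IH]; first by rewrite scale0r addr0.
  rewrite iterS IH (linD lX) (linZ lX) XA XB -addrA; congr (_ + _).
  case: j {IH} => [|j]; first by rewrite scale0r addr0 scale1r.
  by rewrite -[X in X + _]scale1r -scalerDl nat1r.
rewrite /trunc_exp !(lin_sum _ _ lA) (lin_sum _ _ lB).
under eq_bigr => j _ do rewrite XjA scalerDr -(linZ lA).
rewrite big_split /=; congr (_ + _).
rewrite big_ord_recl scale0r scaler0 add0r; apply: eq_bigr => j _.
rewrite (linZ lB) scalerA /= /bump add1n factS natrM invfM -mulrA.
by rewrite [_ * j.+1%:R]mulrC mulrA mulVf ?F0 // mul1r.
Qed.

End TruncatedExponential.

(** * Exponentials of annihilation operators *)

(** The grading with a_{-n} in degree n.  It bounds both the number of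
    annihilation operators that act nontrivially and the order of nilpotency. *)
Definition weight (m : {cmonom nat}) : nat :=
  (\sum_(i <- finsupp m) i.+1 * m i)%N.

Lemma weight_mul m i : weight (mulcm m (ucm i)) = (weight m + i.+1)%N.
Proof.
pose d := (finsupp m `|` [fset i])%fset.
have weightE (m' : {cmonom nat}) : (finsupp m' `<=` d)%fset ->
    weight m' = (\sum_(t <- d) t.+1 * m' t)%N.
  move=> m'd; apply: big_fset_incl => // t _; rewrite -cmE_eq0 => /eqP ->.
  exact: muln0.
have di : i \in d by rewrite !inE eqxx orbT.
have off_i : (\sum_(t <- (d `\ i)%fset) t.+1 * mulcm m (ucm i) t =
              \sum_(t <- (d `\ i)%fset) t.+1 * m t)%N.
  rewrite big_seq [RHS]big_seq; apply: eq_bigr => t.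
  by rewrite !inE mulcmE ucmE => /andP[/negPf ti _]; rewrite eq_sym ti addn0.
rewrite !weightE /d ?mdomD ?mdomU ?fsubsetUl // !(big_fsetD1 i di) /= off_i.
by rewrite mulcmE ucmE eqxx mulnDr muln1 addnAC.
Qed.

Section Bounded.

Variable F : fieldType.
Implicit Types (v : fock F) (d : nat).

Definition bounded d v := forall m, (d < weight m)%N -> v@_m = 0.

Lemma boundedW d d' v : (d <= d')%N -> bounded d v -> bounded d' v.
Proof. by move=> dd bv m dm; apply: bv; apply: leq_ltn_trans dm. Qed.

Lemma bounded_ex v : exists d, bounded d v.
Proof.
exists (\max_(m <- msupp v) weight m)%N => m; rewrite ltnNge => mv.
apply: mcoeff_outdom; apply: contra mv => mv.
exact: leq_bigmax_seq.
Qed.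

Lemma bounded_monom m : bounded (weight m) (<< m >> : fock F).
Proof.
move=> m' lt_m; rewrite mcoeffU1; case: eqP => // mm.
by rewrite mm ltnn in lt_m.
Qed.

Lemma bounded1 : bounded 0 (1 : fock F).
Proof.
move=> m; rewrite mcoeff1; case: eqP => [->|//].
by rewrite /weight mdom1 big_seq_fset0.
Qed.

Lemma bounded_aL d i v : bounded d v -> bounded d.-1 (aL i.+1%:Z v).
Proof.
by move=> bv m dm; rewrite aL_posE bv ?mulr0 // weight_mul; case: d {bv} dm => //= d; lia.
Qed.

Lemma aL_bounded d i v : bounded d v -> (d <= i)%N -> aL i.+1%:Z v = 0.
Proof.
by move=> bv di; apply/malgP => m; rewrite aL_posE bv ?mulr0 ?mcoeff0 // weight_mul; lia.
Qed.

End Bounded.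

Section Taylor.

Variables (F : fieldType) (F0 : char0 F) (V : lmodType F).
Variable tau : nat -> V -> V.
Hypothesis tau_linear : forall i, linear (tau i).
Hypothesis tauC : forall i j f, tau i (tau j f) = tau j (tau i f).
Implicit Types (G : fock F -> V) (v : fock F).

(** The operators tau i commute and stand for the coefficients of the
    generators a_{i+1} / (i+1) in the exponent.  They act on the values of a
    linear map G on M, and annih_gen is the infinitesimal transformation of G:
    working with all the linear maps G at once covers the left action (G is an
    embedding of M) and, by adjunction, the right action (G is a pairing). *)
Definition annih_gen K G v : V :=
  \sum_(i < K) (i.+1%:R)^-1 *: tau i (G (aL i.+1%:Z v)).

Lemma annih_gen_linear K : linear (annih_gen K).
Proof.
move=> c G H; apply/funext => v.
rewrite -[RHS]/(c *: annih_gen K G v + annih_gen K H v) /annih_gen.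
rewrite scaler_sumr -big_split /=; apply: eq_bigr => i _.
rewrite -[(c *: G + H) _]/(c *: G _ + H _) tau_linear scalerDr !scalerA.
by rewrite [_ * c]mulrC.
Qed.

Lemma annih_gen_linearP K G : linear G -> linear (annih_gen K G).
Proof.
move=> lG c v w; rewrite /annih_gen scaler_sumr -big_split /=.
apply: eq_bigr => i _; rewrite aL_linear lG tau_linear scalerDr !scalerA.
by rewrite [_ * c]mulrC.
Qed.

Lemma iter_annih_linear K G j : linear G -> linear (iter j (annih_gen K) G).
Proof. by move=> lG; elim: j => // j IH; apply: annih_gen_linearP. Qed.

(** Leibniz rule: the Heisenberg relation contributes the term tau n. *)
Lemma annih_gen_creator K G n v : linear G -> (n < K)%N ->
  annih_gen K G (creator F n * v) =
  annih_gen K (fun w => G (creator F n * w)) v + tau n (G v).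
Proof.
move=> lG nK; rewrite /annih_gen.
under eq_bigr => i _ do rewrite aL_pos_creator (linD lG) (linD (tau_linear _)) scalerDr.
rewrite big_split /=; congr (_ + _).
rewrite (bigD1 (Ordinal nK)) //= eqxx (linZ lG) (linZ (tau_linear _)).
rewrite scalerA mulVf ?F0 // scale1r big1 ?addr0 // => i ni.
rewrite ifF; last by apply/negbTE; apply: contra ni.
by rewrite (lin0 lG) (lin0 (tau_linear _)) scaler0.
Qed.

Lemma iter_annih_bounded K G d v j : linear G -> bounded d v -> (d < j)%N ->
  iter j (annih_gen K) G v = 0.
Proof.
move=> lG; elim: j d v => // j IH d v bv dj; rewrite iterS /annih_gen big1 // => i _.
have lj := iter_annih_linear K j lG.
case: d bv dj => [|d] bv dj.
  by rewrite (aL_bounded bv) // (lin0 lj) (lin0 (tau_linear _)) scaler0.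
by rewrite (IH d _ (bounded_aL _ bv) dj) (lin0 (tau_linear _)) scaler0.
Qed.

Lemma trunc_expE n (X : (fock F -> V) -> fock F -> V) G v :
  trunc_exp n X G v = \sum_(j < n) (j`!%:R)^-1 *: iter j X G v.
Proof. by rewrite /trunc_exp fct_sumE. Qed.

Lemma trunc_exp_annih_linear n K G : linear G -> linear (trunc_exp n (annih_gen K) G).
Proof.
move=> lG c v w; rewrite !trunc_expE scaler_sumr -big_split /=.
apply: eq_bigr => j _; rewrite (iter_annih_linear K j lG) scalerDr !scalerA.
by rewrite [_ * c]mulrC.
Qed.

(** Commutation of the exponential with the multiplication by a variable: this
    is trunc_exp_comm for the operators G |-> (w |-> G (a_{-(i+1)} w)) and
    G |-> - tau i \o G. *)
Lemma trunc_exp_annih_creator n K G i v : linear G -> (i < K)%N ->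
  trunc_exp n.+1 (annih_gen K) G (creator F i * v) =
  trunc_exp n.+1 (annih_gen K) (fun w => G (creator F i * w)) v +
  tau i (trunc_exp n (annih_gen K) G v).
Proof.
move=> lG iK.
pose A H := (fun w => H (creator F i * w)) : fock F -> V.
pose T H := (fun w => - tau i (H w)) : fock F -> V.
have lA : linear A by [].
have lT : linear T.
  move=> c H H'; apply/funext => w.
  rewrite /T -[(c *: H + H') w]/(c *: H w + H' w) tau_linear opprD.
  by rewrite -scalerN.
have XA j : annih_gen K (A (iter j (annih_gen K) G)) =
    A (iter j.+1 (annih_gen K) G) + T (iter j (annih_gen K) G).
  apply/funext => w; rewrite -[RHS]/(A (iter j.+1 (annih_gen K) G) w +
    T (iter j (annih_gen K) G) w).
  by rewrite /A /T iterS annih_gen_creator ?addrK //; apply: iter_annih_linear.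
have XT j : annih_gen K (T (iter j (annih_gen K) G)) =
    T (iter j.+1 (annih_gen K) G).
  apply/funext => w; rewrite /T iterS /annih_gen (lin_sum _ _ (tau_linear i)).
  rewrite -sumrN; apply: eq_bigr => k _.
  rewrite -scaleN1r (linZ (tau_linear k)) (linZ (tau_linear i)) tauC.
  by rewrite scaleN1r scalerN.
have comm := trunc_exp_comm n F0 (annih_gen_linear K) lA lT XA XT.
by rewrite -/(A G) comm -[RHS]addrA [X in _ + X]addNr addr0.
Qed.

(** Taylor's formula: for every v the exponential, truncated far enough, is
    the only transformation Psi of linear maps for which multiplying v by
    a_{-(n+1)} amounts to substituting a_{-(n+1)} + tau n. *)
Lemma taylor (Psi : (fock F -> V) -> fock F -> V) :
    (forall G, linear G -> linear (Psi G)) ->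
    (forall G, linear G -> Psi G 1 = G 1) ->
    (forall G n v, linear G -> Psi G (creator F n * v) =
       Psi (fun w => G (creator F n * w)) v + tau n (Psi G v)) ->
  forall v, exists d, forall K n G, (d <= K)%N -> (d <= n)%N -> linear G ->
    trunc_exp n (annih_gen K) G v = Psi G v.
Proof.
move=> lPsi Psi1 PsiM v; elim/fock_ind: v => [|i v [d IH]|c v w [d IHv] [d' IHw]].
- exists 1%N => K [//|n] G _ _ lG; rewrite Psi1 // trunc_expE big_ord_recl.
  rewrite fact0 invr1 scale1r big1 ?addr0 // => j _.
  by rewrite (iter_annih_bounded _ lG (@bounded1 F)) ?scaler0.
- exists (maxn i.+1 d.+1) => K [|n] G; rewrite ?geq_max ?andbF //.
  move=> /andP[iK dK] /andP[_ dn] lG.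
  have lAG : linear (fun w => G (creator F i * w)).
    by move=> c u w; rewrite mulrDr -scalerAr lG.
  rewrite trunc_exp_annih_creator // PsiM //.
  by rewrite (IH _ _ _ (ltnW dK) (leqW dn)) // (IH _ _ _ (ltnW dK) dn).
- exists (maxn d d') => K n G; rewrite !geq_max => /andP[dK d'K] /andP[dn d'n] lG.
  by rewrite lPsi // trunc_exp_annih_linear // IHv ?IHw.
Qed.

(** The same for the exponential of an operator X on V, when X agrees with
    annih_gen along the maps G of a stable class Q. *)
Lemma opexp_taylor S X Psi (Q : (fock F -> V) -> Prop) : summation S ->
    (forall G, Q G -> linear G) -> (forall K G, Q G -> Q (annih_gen K G)) ->
    (forall K G v, Q G -> bounded K v -> X (G v) = annih_gen K G v) ->
    (forall G, linear G -> linear (Psi G)) ->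
    (forall G, linear G -> Psi G 1 = G 1) ->
    (forall G n v, linear G -> Psi G (creator F n * v) =
       Psi (fun w => G (creator F n * w)) v + tau n (Psi G v)) ->
  forall G v, Q G -> opexp S X (G v) = Psi G v.
Proof.
move=> sS lQ QX XE lPsi Psi1 PsiM G v QG.
have [d Taylor] := taylor lPsi Psi1 PsiM v.
have [d' bv] := bounded_ex v.
pose n := maxn d d'.+1; have bn : bounded n v by apply: boundedW bv; lia.
have iterE j : iter j X (G v) = iter j (annih_gen n) G v.
  suff [] : iter j X (G v) = iter j (annih_gen n) G v /\ Q (iter j (annih_gen n) G) by [].
  elim: j => // j [IH Qj]; split; last exact: QX.
  by rewrite !iterS IH (XE n).
rewrite (@opexp_trunc _ _ S n) //; last first.
  by move=> j nj; rewrite iterE (iter_annih_bounded _ (lQ _ QG) bv) //; lia.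
rewrite -(Taylor n n) ?leq_maxl //; last exact: lQ.
by rewrite trunc_expE; apply: eq_bigr => j _; rewrite iterE.
Qed.

End Taylor.

(** * Laurent polynomials symmetric under inversion *)

(** z^n + z^{-n} as a polynomial in z + z^{-1}. *)
Fixpoint power_sum2 (A : comNzRingType) n : {poly A} :=
  if n is n'.+1 then
    if n' is m.+1 then power_sum2 A n' * 'X - power_sum2 A m else 'X
  else 2.

Section Substitution.

Variables (F : fieldType) (A : comAlgType F) (V : lmodType F).
Implicit Types (G : A -> int -> V) (P Q : {poly A}) (f : int -> V).

Definition sym_shift f : int -> V := fun k => f (k + 1) + f (k - 1).

(** P(z + z^{-1}), where the coefficient u of P becomes the series G u: sym_shift
    is the multiplication of a series by z + z^{-1}. *)
Definition laurent G P : int -> V :=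
  \sum_(j < size P) iter j sym_shift (G P`_j).

Lemma sym_shift_linear : linear sym_shift.
Proof.
move=> c f g; apply/funext => k.
rewrite /sym_shift -[RHS]/(c *: (f (k + 1) + f (k - 1)) + (g (k + 1) + g (k - 1))).
by rewrite scalerDr addrACA.
Qed.

Lemma laurentE n G P : linear G -> (size P <= n)%N ->
  laurent G P = \sum_(j < n) iter j sym_shift (G P`_j).
Proof.
move=> lG Pn; rewrite /laurent.
rewrite -!(big_mkord xpredT (fun j => iter j sym_shift (G P`_j))).
rewrite (big_cat_nat (leq0n _) Pn) /= -[LHS]addr0; congr (_ + _).
rewrite big_nat big1 // => j /andP[Pj _]; rewrite nth_default // (lin0 lG).
exact: (lin0 (iter_linear j sym_shift_linear)).
Qed.

Lemma laurentD G P Q : linear G -> laurent G (P + Q) = laurent G P + laurent G Q.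
Proof.
move=> lG; pose n := maxn (size P) (size Q).
rewrite !(@laurentE n) ?leq_maxl ?leq_maxr //; last exact: size_polyD.
rewrite -big_split; apply: eq_bigr => j _; rewrite coefD (linD lG).
exact: (linD (iter_linear j sym_shift_linear)).
Qed.

Lemma laurent0 G : laurent G 0 = 0.
Proof. by rewrite /laurent size_poly0 big_ord0. Qed.

Lemma laurentN G P : linear G -> laurent G (- P) = - laurent G P.
Proof. by move=> lG; apply/eqP; rewrite -addr_eq0 -laurentD // addNr laurent0. Qed.

Lemma laurentB G P Q : linear G -> laurent G (P - Q) = laurent G P - laurent G Q.
Proof. by move=> lG; rewrite laurentD // laurentN. Qed.

Lemma laurentC G u : linear G -> laurent G u%:P = G u.
Proof.
by move=> lG; rewrite (@laurentE 1) ?size_polyC ?leq_b1 // big_ord1 coefC.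
Qed.

Lemma laurentMX G P : linear G -> laurent G (P * 'X) = sym_shift (laurent G P).
Proof.
move=> lG; have Xsize : (size (P * 'X)%R <= (size P).+1)%N.
  by apply: leq_trans (size_polyMleq _ _) _; rewrite size_polyX addn2.
rewrite (laurentE lG Xsize) big_ord_recl coefMX /= (lin0 lG) add0r.
rewrite /laurent (lin_sum _ _ sym_shift_linear); apply: eq_bigr => j _.
by rewrite coefMX.
Qed.

Lemma laurentMC G u P : linear G ->
  laurent G (u%:P * P) = laurent (fun w => G (u * w)) P.
Proof.
move=> lG; rewrite (@laurentE (size P)) //.
  by rewrite /laurent; apply: eq_bigr => j _; rewrite coefCM.
by rewrite mul_polyC size_scale_leq.
Qed.

Lemma laurentZ G c P : linear G -> laurent G ((c%:A)%:P * P) = c *: laurent G P.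
Proof.
move=> lG; rewrite laurentMC // /laurent scaler_sumr; apply: eq_bigr => j _.
by rewrite mulr_algl (linZ lG) (linZ (iter_linear j sym_shift_linear)).
Qed.

Lemma laurent_power_sum2 G n P k : linear G ->
  laurent G (power_sum2 A n * P) k = laurent G P (k + n%:Z) + laurent G P (k - n%:Z).
Proof.
move=> lG; have [m] := ubnP n; elim: m n k => // m IH [|[|n]] k lt_n.
- by rewrite /= mulr2n mulrDl mul1r laurentD // !addr0.
- by rewrite /= mulrC laurentMX.
rewrite /= -/(power_sum2 A n.+1) mulrBl laurentB // mulrAC laurentMX //.
rewrite -[LHS]/(laurent G (power_sum2 A n.+1 * P) (k + 1) +
  laurent G (power_sum2 A n.+1 * P) (k - 1) - laurent G (power_sum2 A n * P) k).
rewrite !IH; try lia.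
have e1 : k + 1 + n.+1%:Z = k + n.+2%:Z by lia.
have e2 : k + 1 - n.+1%:Z = k - n%:Z by lia.
have e3 : k - 1 + n.+1%:Z = k + n%:Z by lia.
have e4 : k - 1 - n.+1%:Z = k - n.+2%:Z by lia.
rewrite e1 e2 e3 e4; move: (laurent G P) => f.
rewrite [f (k + n%:Z) + f (k - n.+2%:Z)]addrC addrACA.
by rewrite [f (k - n%:Z) + _]addrC addrK.
Qed.

End Substitution.

Lemma laurent_comp (F : fieldType) (A : comAlgType F) (V W : lmodType F)
  (h : V -> W) (G : A -> int -> V) P k : linear h -> linear G ->
  h (laurent G P k) = laurent (fun u k => h (G u k)) P k.
Proof.
move=> lh lG; rewrite /laurent !fct_sumE (lin_sum _ _ lh); apply: eq_bigr => j _.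
by move: P`_j => u; elim: (nat_of_ord j) k => //= i IH k; rewrite /sym_shift (linD lh) !IH.
Qed.

(** * The three exponentials of annihilation operators *)

Section AnnihilationInstances.

Variables (F : fieldType) (F0 : char0 F).
Implicit Types (v w : fock F) (u : dual_fock F).

Definition shift_eval (p : nat -> F) : fock F -> fock F :=
  fock_eval (in_alg (fock F)) (fun i => creator F i + (p i)%:A).

HB.instance Definition _ p := GRing.RMorphism.on (shift_eval p).

Lemma shift_evalM p : {morph shift_eval p : v w / v * w}.
Proof. exact: rmorphM. Qed.

Lemma shift_evalD p : {morph shift_eval p : v w / v + w}.
Proof. exact: rmorphD. Qed.

Lemma shift_eval1 p : shift_eval p 1 = 1.
Proof. exact: rmorph1. Qed.

Lemma shift_evalZ p c v : shift_eval p (c *: v) = c *: shift_eval p v.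
Proof. by rewrite /shift_eval fock_evalZ mulr_algl. Qed.

Lemma shift_eval_creator p i : shift_eval p (creator F i) = creator F i + (p i)%:A.
Proof. exact: fock_eval_creator. Qed.

(** a_{-n} |-> a_{-n} + c (z^n + z^{-n}), as a polynomial in s = z + z^{-1}. *)
Definition laurent_eval (c : F) : fock F -> {poly fock F} :=
  fock_eval (polyC \o in_alg (fock F))
    (fun i => (creator F i)%:P + (c%:A)%:P * power_sum2 (fock F) i.+1).

HB.instance Definition _ c := GRing.RMorphism.on (laurent_eval c).

Lemma laurent_evalD c : {morph laurent_eval c : v w / v + w}.
Proof. exact: rmorphD. Qed.

Lemma laurent_eval1 c : laurent_eval c 1 = 1.
Proof. exact: rmorph1. Qed.

Lemma laurent_evalZ c a v : laurent_eval c (a *: v) = (a%:A)%:P * laurent_eval c v.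
Proof. exact: fock_evalZ. Qed.

Lemma laurent_eval_creator c i : laurent_eval c (creator F i) =
  (creator F i)%:P + (c%:A)%:P * power_sum2 (fock F) i.+1.
Proof. exact: fock_eval_creator. Qed.

Lemma annih_gen_commute (V : lmodType F) (tau : nat -> V -> V) K (a : V -> V) j G :
    (forall i, linear (tau i)) -> linear a ->
    (forall i f, a (tau i f) = tau i (a f)) ->
    (forall w, a (G w) = G (aL j.+1%:Z w)) ->
  forall w, a (annih_gen tau K G w) = annih_gen tau K G (aL j.+1%:Z w).
Proof.
move=> lt la at_ aG w; rewrite /annih_gen (lin_sum _ _ la).
by apply: eq_bigr => i _; rewrite (linZ la) at_ aG aL_posC.
Qed.

(** Gamma_+(y) is the automorphism a_{-n} |-> a_{-n} + y^n. *)
Lemma Gamma_plusE y v : Gamma_plus y v = shift_eval (fun i => y ^+ i.+1) v.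
Proof.
pose tau i w : fock F := y ^+ i.+1 *: w.
have lt i : linear (tau i) by move=> c u w; rewrite /tau scalerDr !scalerA mulrC.
have tC i j w : tau i (tau j w) = tau j (tau i w) by rewrite /tau !scalerA mulrC.
pose Q (G : fock F -> fock F) :=
  linear G /\ forall i w, aL i.+1%:Z (G w) = G (aL i.+1%:Z w).
pose Psi (G : fock F -> fock F) v := G (shift_eval (fun i => y ^+ i.+1) v).
apply: (@opexp_taylor F F0 (fock F) tau lt tC fsum _ Psi Q _ _ _ _ _ _ _ idfun).
- exact: fsum_summation.
- by move=> G [].
- move=> K G [lG cG]; split; first exact: annih_gen_linearP.
  move=> i; apply: annih_gen_commute => //; first exact: aL_linear.
  by move=> j f; rewrite /tau (linZ (aL_linear _)).
- move=> K G w [lG cG] bw; rewrite (@fsum_summation _ _ K) => [|i Ki].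
    by apply: eq_bigr => i _; rewrite cG /tau scalerA [_^-1 * _]mulrC.
  by rewrite cG (aL_bounded bw Ki) (lin0 lG) scaler0.
- by move=> G lG c u w; rewrite /Psi rmorphD /= shift_evalZ lG.
- by move=> G lG; rewrite /Psi rmorph1.
- move=> G n w lG; rewrite /Psi rmorphM /= shift_eval_creator mulrDl (linD lG).
  by rewrite mulr_algl /tau (linZ lG).
- by split.
Qed.

Section LaurentTaylor.

Variables (V : lmodType F) (c : F) (G : fock F -> int -> V).
Hypothesis lG : linear G.

(** Multiplication of a series by c (z^{i+1} + z^{-i-1}). *)
Definition laurent_tau i (f : int -> V) : int -> V :=
  fun k => c *: (f (k + i.+1%:Z) + f (k - i.+1%:Z)).

Lemma laurent_tau_linear i : linear (laurent_tau i).
Proof.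
move=> a f g; apply/funext => k.
rewrite /laurent_tau -[RHS]/(a *: (c *: (f (k + i.+1%:Z) + f (k - i.+1%:Z))) +
  c *: (g (k + i.+1%:Z) + g (k - i.+1%:Z))).
rewrite -[LHS]/(c *: ((a *: f (k + i.+1%:Z) + g (k + i.+1%:Z)) +
  (a *: f (k - i.+1%:Z) + g (k - i.+1%:Z)))).
by rewrite addrACA !scalerDr !scalerA [a * c]mulrC.
Qed.

Lemma laurent_tauC i j f : laurent_tau i (laurent_tau j f) = laurent_tau j (laurent_tau i f).
Proof.
apply/funext => k; rewrite /laurent_tau -!scalerDr; congr (_ *: (_ *: _)).
rewrite addrACA; congr (f _ + f _ + (f _ + f _)); lia.
Qed.

Lemma laurent_eval_taylor_linear : linear (fun v => laurent G (laurent_eval c v)).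
Proof. by move=> a v w; rewrite laurent_evalD laurent_evalZ laurentD // laurentZ. Qed.

Lemma laurent_eval_taylor1 : laurent G (laurent_eval c 1) = G 1.
Proof. by rewrite rmorph1 -(laurentC _ lG) polyC1. Qed.

Lemma laurent_eval_taylor_creator n v :
  laurent G (laurent_eval c (creator F n * v)) =
  laurent (fun w => G (creator F n * w)) (laurent_eval c v) +
  laurent_tau n (laurent G (laurent_eval c v)).
Proof.
rewrite rmorphM /= laurent_eval_creator mulrDl laurentD // laurentMC //.
congr (_ + _); rewrite -mulrA laurentZ //; apply/funext => k.
by rewrite -[LHS]/(c *: laurent G _ k) laurent_power_sum2.
Qed.

End LaurentTaylor.

Lemma const_series_linear : linear (@const_series F (fock F)).
Proof.
move=> c v w; apply/funext => k.
rewrite -[RHS]/(c *: const_series v k + const_series w k) /const_series.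
by case: eqP; rewrite ?scaler0 ?addr0.
Qed.

Lemma exp_annihilation_left c v :
  exp_annihilation fsum aL c (const_series v) = laurent const_series (laurent_eval c v).
Proof.
pose Q (G : fock F -> int -> fock F) :=
  linear G /\ forall i w k, aL i.+1%:Z (G w k) = G (aL i.+1%:Z w) k.
pose Psi (G : fock F -> int -> fock F) v := laurent G (laurent_eval c v).
apply: (@opexp_taylor F F0 _ (laurent_tau c) (laurent_tau_linear c) (laurent_tauC c)
  _ _ Psi Q _ _ _ _ _ _ _ const_series).
- exact/pwsum_summation/fsum_summation.
- by move=> G [].
- move=> K G [lG cG]; split.
    by apply: annih_gen_linearP => //; apply: laurent_tau_linear.
  move=> i w k.
  pose a (f : int -> fock F) := (fun k => aL i.+1%:Z (f k)) : int -> fock F.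
  apply: (congr1 (fun f => f k) (@annih_gen_commute _ _ K a i G _ _ _ _ w)).
  + exact: laurent_tau_linear.
  + by move=> b f g; apply/funext => k'; apply: aL_linear.
  + move=> j f; apply/funext => k'.
    by rewrite /a /laurent_tau (linZ (aL_linear _)) (linD (aL_linear _)).
  + by move=> w'; apply/funext => k'; apply: cG.
- move=> K G w [lG cG] bw; apply/funext => k.
  rewrite (@fsum_summation _ _ K) => [|i Ki].
    rewrite /annih_gen fct_sumE; apply: eq_bigr => i _.
    rewrite (linD (aL_linear _)) !cG -[RHS]/(_^-1 *: (c *: _)) scalerA.
    by rewrite [_^-1 * _]mulrC.
  rewrite (linD (aL_linear _)) !cG (aL_bounded bw Ki) (lin0 lG).
  by rewrite addr0 scaler0.
- exact: laurent_eval_taylor_linear.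
- exact: laurent_eval_taylor1.
- by move=> G n w lG; apply: laurent_eval_taylor_creator.
- split=> [|i w k]; first exact: const_series_linear.
  by rewrite /const_series; case: eqP => // _; rewrite (lin0 (aL_linear _)).
Qed.

Lemma pairing_linearl v c u u' :
  pairing (c *: u + u') v = c * pairing u v + pairing u' v.
Proof.
rewrite /pairing mulr_sumr -big_split /=; apply: eq_bigr => m _.
by rewrite -[(c *: u + u') m]/(c * u m + u' m) mulrDr mulrDl mulrCA !mulrA.
Qed.

Lemma mono_norm_neq0 m : mono_norm m != 0 :> F.
Proof.
rewrite /mono_norm; elim/big_ind: _ => [|x y|i _]; first exact: oner_neq0.
  exact: mulf_neq0.
by rewrite natrM mulf_neq0 ?fact_neq0 // natrX expf_neq0.
Qed.

Lemma pairing_monom u m : pairing u << m >> = u m * mono_norm m.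
Proof. by rewrite pairingU mul1r. Qed.

Lemma pairing_sum (f : nat -> dual_fock F) n v :
    (forall i m, m \in msupp v -> (n <= i)%N -> f i m = 0) ->
  pairing (pwsum fsum f) v = \sum_(i < n) pairing (f i) v.
Proof.
move=> f0; rewrite /pairing exchange_big /= big_seq [RHS]big_seq.
apply: eq_bigr => m mv; rewrite /pwsum (@fsum_summation _ _ n); last first.
  by move=> i; apply: f0.
by rewrite mulr_sumr mulr_suml.
Qed.

Lemma bounded_msupp d v m : bounded d v -> m \in msupp v -> (weight m <= d)%N.
Proof. by rewrite -mcoeff_neq0 leqNgt => bv; apply: contra => /bv ->. Qed.

Lemma aR_bounded i u m : (weight m <= i)%N -> aR i.+1%:Z u m = 0.
Proof.
move=> wm; apply: (mulIf (mono_norm_neq0 m)); rewrite mul0r -pairing_monom pairing_aR.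
rewrite (aL_bounded _ wm); last exact: bounded_monom.
by rewrite /pairing msupp0 big_seq_fset0.
Qed.

(** The exponential of the right action has infinitely many nonzero terms, but
    paired with v it only involves the operators that lower the weight of v;
    moving them to the right gives the exponential of the left action. *)
Lemma exp_annihilation_right c (U : int -> dual_fock F) k v :
  pairing (exp_annihilation (pwsum fsum) aR c U k) v =
  laurent (fun w k => pairing (U k) w : F^o) (laurent_eval c v) k.
Proof.
pose tau := @laurent_tau F^o c.
pose X : (int -> dual_fock F) -> int -> dual_fock F := fun f k =>
  pwsum fsum (fun i =>
    (c / i.+1%:R) *: aR i.+1%:Z (f (k + i.+1%:Z) + f (k - i.+1%:Z))).
pose G (f : int -> dual_fock F) : fock F -> int -> F^o := fun w k => pairing (f k) w.
have lG f : linear (G f).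
  by move=> a v1 v2; apply/funext => k'; apply: pairing_linear.
have lp w : linear (fun u => pairing u w : F^o) by exact: pairing_linearl.
have lt := @laurent_tau_linear F^o c.
have tC := @laurent_tauC F^o c.
have GX f K w : bounded K w -> G (X f) w = annih_gen tau K (G f) w.
  move=> bw; apply/funext => k'; rewrite /annih_gen fct_sumE /G /X.
  rewrite (@pairing_sum _ K) => [|i m mw Ki].
    apply: eq_bigr => i _.
    rewrite (linZ (lp w)) pairing_aR (linD (lp _)).
    rewrite -[RHS]/(_^-1 *: (c *: (pairing _ _ + pairing _ _ : F^o))) scalerA.
    by rewrite [_^-1 * _]mulrC.
  have wm := leq_trans (bounded_msupp bw mw) Ki.
  by rewrite -[LHS]/(_ * aR _ _ m) aR_bounded ?mulr0.
have GXj f K j w : bounded K w -> G (iter j X f) w = iter j (annih_gen tau K) (G f) w.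
  elim: j w => // j IH w bw; rewrite !iterS (GX _ K) // /annih_gen.
  apply: eq_bigr => i _; rewrite IH //; apply: boundedW (bounded_aL _ bw).
  exact: leq_pred.
pose Psi (H : fock F -> int -> F^o) v := laurent H (laurent_eval c v).
have [d Taylor] := @taylor F F0 _ tau lt tC Psi (@laurent_eval_taylor_linear F^o c)
  (@laurent_eval_taylor1 F^o c) (fun H n v lH => laurent_eval_taylor_creator c lH n v) v.
have [d' bv] := bounded_ex v.
pose n := maxn d d'.+1; have bn : bounded n v by apply: boundedW bv; lia.
have iterX0 j m : m \in msupp v -> (n <= j)%N -> iter j X U k m = 0.
  move=> mv nj; apply: (mulIf (mono_norm_neq0 m)); rewrite mul0r -pairing_monom.
  have bm := @bounded_monom F m; have wm := bounded_msupp bv mv.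
  rewrite -/(G (iter j X U) << m >> k) (GXj _ _ _ _ bm).
  by rewrite (iter_annih_bounded lt _ (lG U) bm) //; lia.
rewrite (@pairing_sum _ n) => [|j m mv nj]; last first.
  by rewrite -[LHS]/(_ * iter j X U k m) iterX0 ?mulr0.
rewrite -[RHS]/(Psi (G U) v k) -(Taylor n n) ?leq_maxl // trunc_expE fct_sumE.
apply: eq_bigr => j _; rewrite (linZ (lp v)) -(GXj _ _ _ _ bn).
by [].
Qed.

End AnnihilationInstances.

(** * Newton's identities *)

Section Newton.

Variable A : comNzRingType.
Implicit Types (p q h f g : nat -> A).

(** Newton's identities between the power sums and the complete homogeneous
    functions: the series H of h and P of p satisfy H' = P H.  The value p i
    is the power sum of degree i+1. *)
Definition newton p h :=
  h 0%N = 1 /\ forall m, h m.+1 *+ m.+1 = \sum_(i < m.+1) p i * h (m - i)%N.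

Definition conv f g (m : nat) : A := \sum_(a < m.+1) f a * g (m - a)%N.

Definition torsion_free := forall (a : A) n, a *+ n.+1 = 0 -> a = 0.

Lemma newton_uniq p h h' : torsion_free -> newton p h -> newton p h' -> h =1 h'.
Proof.
move=> tf [h0 hS] [h'0 h'S] m; have [n] := ubnP m.
elim: n m => // n IH [|m] lt_m; first by rewrite h0 h'0.
apply/eqP; rewrite -subr_eq0; apply/eqP/(tf _ m); rewrite mulrnBl hS h'S.
by apply/eqP; rewrite subr_eq0; apply/eqP/eq_bigr => i _; rewrite IH //; lia.
Qed.

Definition trunc_poly (n : nat) f : {poly A} := \poly_(i < n) f i.

Lemma coef_trunc_polyM n f g m : (m < n)%N ->
  (trunc_poly n f * trunc_poly n g)`_m = conv f g m.
Proof.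
move=> mn; rewrite coefM; apply: eq_bigr => i _.
by rewrite !coef_poly !ifT //; case: i => /= i; lia.
Qed.

Lemma newton_deriv n p h m : newton p h -> (m < n)%N ->
  ((trunc_poly n.+1 h)^`())`_m = (trunc_poly n.+1 p * trunc_poly n.+1 h)`_m.
Proof.
move=> [_ hS] mn; rewrite coef_deriv coef_trunc_polyM ?leqW // coef_poly ltnS mn.
exact: hS.
Qed.

(** Products of the series H correspond to sums of the series P, which are
    logarithmic derivatives. *)
Lemma newton_conv p q f g : newton p f -> newton q g ->
  newton (fun i => p i + q i) (conv f g).
Proof.
move=> nf ng; split=> [|m].
  by rewrite /conv big_ord1 nf.1 ng.1 mulr1.
rewrite -(@coef_trunc_polyM m.+2) // -coef_deriv derivM coefD.
have -> : ((trunc_poly m.+2 f)^`() * trunc_poly m.+2 g)`_m =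
          (trunc_poly m.+2 p * (trunc_poly m.+2 f * trunc_poly m.+2 g))`_m.
  rewrite mulrA !coefM; apply: eq_bigr => i _; congr (_ * _).
  by apply: newton_deriv => //; case: i.
have -> : (trunc_poly m.+2 f * (trunc_poly m.+2 g)^`())`_m =
          (trunc_poly m.+2 q * (trunc_poly m.+2 f * trunc_poly m.+2 g))`_m.
  rewrite mulrCA !coefM; apply: eq_bigr => i _; congr (_ * _).
  by apply: newton_deriv => //; rewrite ltnS leq_subr.
rewrite -coefD -mulrDl coefM; apply: eq_bigr => i _.
by rewrite coef_trunc_polyM ?coefD ?coef_poly ?ifT //; case: i => /= i; lia.
Qed.

End Newton.

Lemma newton_rmorph (A B : comNzRingType) (f : {rmorphism A -> B}) p h :
  newton p h -> newton (fun i => f (p i)) (fun m => f (h m)).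
Proof.
move=> [h0 hS]; split=> [|m]; first by rewrite h0 rmorph1.
by rewrite -rmorphMn hS rmorph_sum; apply: eq_bigr => i _; rewrite rmorphM.
Qed.

Lemma torsion_free_alg (F : fieldType) (A : comAlgType F) : char0 F -> torsion_free A.
Proof.
move=> F0 a n /eqP; rewrite -scaler_nat => /eqP an.
by rewrite -[a]scale1r -(mulVf (F0 n)) -scalerA an scaler0.
Qed.

Lemma torsion_free_poly (A : comNzRingType) : torsion_free A -> torsion_free {poly A}.
Proof.
move=> tf a n an; apply/polyP => i; rewrite coef0; apply: (tf _ n).
by rewrite -coefMn an coef0.
Qed.

(** * Exponentials of creation operators *)

Section Creation.

Variables (F : fieldType) (F0 : char0 F) (V : lmodType F).
Variables (S : (nat -> V) -> V) (a : int -> V -> V) (c : F).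
Hypothesis sS : summation S.
Hypothesis a_linear : forall i, linear (a (- i.+1%:Z)).
Hypothesis aC : forall i j v,
  a (- i.+1%:Z) (a (- j.+1%:Z) v) = a (- j.+1%:Z) (a (- i.+1%:Z) v).
Implicit Types (f g : int -> V) (k : int).

Definition vanish_below (k0 : int) f := forall k, k < k0 -> f k = 0.

(** All the series met here vanish in low degrees, so that the exponent and
    its powers have finitely many terms in each degree. *)
Definition creation_gen f k : V :=
  S (fun i => (c / i.+1%:R) *: a (- i.+1%:Z) (f (k - i.+1%:Z))).

Definition creation_gen_trunc K f : int -> V :=
  fun k => \sum_(i < K) (c / i.+1%:R) *: a (- i.+1%:Z) (f (k - i.+1%:Z)).

Lemma creation_gen_trunc_linear K : linear (creation_gen_trunc K).
Proof.
move=> b f g; apply/funext => k.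
rewrite -[RHS]/(b *: creation_gen_trunc K f k + creation_gen_trunc K g k).
rewrite /creation_gen_trunc scaler_sumr -big_split /=; apply: eq_bigr => i _.
rewrite -[(b *: f + g) _]/(b *: f (k - i.+1%:Z) + g (k - i.+1%:Z)) a_linear.
by rewrite scalerDr !scalerA [b * _]mulrC.
Qed.

Lemma creation_gen_truncE k0 K f k : vanish_below k0 f -> k <= k0 + K%:Z ->
  creation_gen f k = creation_gen_trunc K f k.
Proof.
move=> vf kK; apply: sS => i Ki.
by rewrite vf ?(lin0 (a_linear i)) ?scaler0 //; lia.
Qed.

Lemma vanish_iter_creation k0 f j :
  vanish_below k0 f -> vanish_below (k0 + j%:Z) (iter j creation_gen f).
Proof.
move=> vf; elim: j => [|j IH] k kj; first by apply: vf; lia.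
rewrite iterS (@creation_gen_truncE (k0 + j%:Z) 0) ?addr0 //; last lia.
by rewrite /creation_gen_trunc big_ord0.
Qed.

Lemma iter_creation_trunc k0 K f k j : vanish_below k0 f -> k <= k0 + K%:Z ->
  iter j creation_gen f k = iter j (creation_gen_trunc K) f k.
Proof.
move=> vf; elim: j k => // j IH k kK.
have vj : vanish_below k0 (iter j creation_gen f).
  by have vk := vanish_iter_creation (j := j) vf; move=> k' k'k; rewrite vk //; lia.
rewrite !iterS (creation_gen_truncE vj kK); apply: eq_bigr => i _.
by rewrite IH //; lia.
Qed.

Lemma exp_creation_trunc k0 K n f k :
    vanish_below k0 f -> k <= k0 + K%:Z -> k < k0 + n%:Z ->
  exp_creation S a c f k = trunc_exp n (creation_gen_trunc K) f k.
Proof.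
move=> vf kK Kn; rewrite /exp_creation -/creation_gen /opexp /pwsum.
rewrite (sS (n := n)) => [|j nj].
  rewrite /trunc_exp fct_sumE; apply: eq_bigr => j _.
  by rewrite -[LHS]/(_ *: iter j creation_gen f k) (iter_creation_trunc _ vf kK).
rewrite -[LHS]/(_ *: iter j creation_gen f k).
by rewrite (vanish_iter_creation (j := j) vf) ?scaler0 //; lia.
Qed.

Lemma exp_creationD k0 f g : vanish_below k0 f -> vanish_below k0 g ->
  exp_creation S a c (f + g) = exp_creation S a c f + exp_creation S a c g.
Proof.
move=> vf vg; apply/funext => k; pose K := `|k - k0|%N.
have kK : k <= k0 + K%:Z by rewrite /K; lia.
rewrite -[RHS]/(exp_creation S a c f k + exp_creation S a c g k).
rewrite !(@exp_creation_trunc k0 K K.+1) //; try lia; last first.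
  move=> k' k'k; rewrite -[LHS]/(f k' + g k') vf ?vg ?addr0 //.
by rewrite (linD (trunc_exp_linear _ (creation_gen_trunc_linear K))).
Qed.

Lemma exp_creation_shift f s k :
  exp_creation S a c (fun k => f (k + s)) k = exp_creation S a c f (k + s).
Proof.
rewrite /exp_creation -/creation_gen /opexp /pwsum; congr S; apply/funext => j.
rewrite -[LHS]/(_ *: iter j creation_gen (fun k => f (k + s)) k).
rewrite -[RHS]/(_ *: iter j creation_gen f (k + s)); congr (_ *: _).
elim: j k => // j IH k; rewrite !iterS; congr S; apply/funext => i.
by rewrite IH addrAC.
Qed.

Lemma exp_creation_sym_shift k0 f : vanish_below k0 f ->
  exp_creation S a c (sym_shift f) = sym_shift (exp_creation S a c f).
Proof.
move=> vf; rewrite -[sym_shift f]/((fun k => f (k + 1)) + (fun k => f (k + - 1))).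
rewrite (@exp_creationD (k0 - 1)).
- by apply/funext => k; rewrite /sym_shift -!exp_creation_shift.
- by move=> k kk; apply: vf; lia.
- by move=> k kk; apply: vf; lia.
Qed.

(** Newton's recursion for the exponential.  It is trunc_exp_comm for the
    operator z d/dz, whose bracket with the exponent is the derivative of the
    latter, c \sum_n a_{-n} z^n up to sign. *)
Lemma exp_creation_const v :
  [/\ forall k, k < 0 -> exp_creation S a c (const_series v) k = 0,
      exp_creation S a c (const_series v) 0 = v &
      forall m, exp_creation S a c (const_series v) m.+1%:Z *+ m.+1 =
        \sum_(i < m.+1) c *: a (- i.+1%:Z)
          (exp_creation S a c (const_series v) (m - i)%N%:Z)].
Proof.
have vc : vanish_below 0 (const_series v).
  by move=> k k0; rewrite /const_series ifF //; lia.
split=> [k k0||m].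
- rewrite (@exp_creation_trunc 0 0 1 _ k vc); try lia.
  by rewrite /trunc_exp big_ord1 /= -[LHS]/(_ *: const_series v k) vc ?scaler0.
- rewrite (exp_creation_trunc (K := 0) (n := 1) vc) //.
  by rewrite /trunc_exp big_ord1 /= -[LHS]/(1%:R^-1 *: v) invr1 scale1r.
pose K := m.+1; pose X := creation_gen_trunc K.
(* z d/dz and minus the derivative of the exponent *)
pose N f : int -> V := fun k => k%:~R *: f k.
pose Y f : int -> V := fun k => - \sum_(i < K) c *: a (- i.+1%:Z) (f (k - i.+1%:Z)).
have lX : linear X by exact: creation_gen_trunc_linear.
have lN : linear N.
  move=> b f g; apply/funext => k.
  rewrite -[LHS]/(_ *: (b *: f k + g k)) -[RHS]/(b *: (_ *: f k) + _ *: g k).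
  by rewrite scalerDr !scalerA [b * _]mulrC.
have lY : linear Y.
  move=> b f g; apply/funext => k.
  rewrite -[RHS]/(b *: Y f k + Y g k) /Y scalerN -opprD scaler_sumr -big_split /=.
  congr (- _); apply: eq_bigr => i _.
  rewrite -[(b *: f + g) _]/(b *: f (k - i.+1%:Z) + g (k - i.+1%:Z)) a_linear.
  by rewrite scalerDr !scalerA [b * _]mulrC.
have XN f : X (N f) = N (X f) + Y f.
  apply/funext => k; rewrite -[RHS]/(k%:~R *: X f k + Y f k).
  rewrite /X /Y /creation_gen_trunc scaler_sumr -sumrN -big_split /=.
  apply: eq_bigr => i _; rewrite /N (linZ (a_linear i)) !scalerA -scalerBl.
  congr (_ *: _); rewrite intrB mulrBr mulrC; congr (_ - _).
  by rewrite -[i.+1%:Z%:~R]/(i.+1%:R) mulfVK.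
have XY f : X (Y f) = Y (X f).
  apply/funext => k; rewrite /X /Y /creation_gen_trunc.
  under [in RHS]eq_bigr => i _ do rewrite (lin_sum _ _ (a_linear i)) scaler_sumr.
  rewrite exchange_big /= -sumrN; apply: eq_bigr => i _.
  rewrite -[in LHS]scaleN1r (linZ (a_linear i)) (lin_sum _ _ (a_linear i)) scaleN1r scalerN.
  rewrite scaler_sumr; congr (- _); apply: eq_bigr => j _.
  rewrite !(linZ (a_linear _)) !scalerA mulrC aC; congr (_ *: a _ (a _ (f _))); lia.
have := @trunc_exp_comm F _ m.+1 X N Y (const_series v) F0 lX lN lY
  (fun j => XN _) (fun j => XY _).
have -> : N (const_series v) = 0.
  apply/funext => k; rewrite /N /const_series.
  by case: eqP => [->|_]; rewrite ?scale0r ?scaler0.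
rewrite (lin0 (trunc_exp_linear _ lX)) => /(congr1 (fun f => f m.+1%:Z)).
rewrite -[LHS]/0 -[X in _ = X -> _]/(m.+1%:R *: trunc_exp m.+2 X (const_series v) m.+1%:Z
  - \sum_(i < K) c *: a (- i.+1%:Z) (trunc_exp m.+1 X (const_series v) (m.+1%:Z - i.+1%:Z))).
move/eqP; rewrite eq_sym subr_eq0 => /eqP.
rewrite -(@exp_creation_trunc 0 K m.+2 _ _ vc); try lia.
rewrite scaler_nat => ->.
apply: eq_bigr => i _; rewrite -(@exp_creation_trunc 0 K m.+1 _ _ vc); try lia.
congr (_ *: a _ (exp_creation _ _ _ _ _)); case: i => /= i; lia.
Qed.

End Creation.

Definition int_ext (V : nmodType) (h : nat -> V) (k : int) : V :=
  if k is Posz m then h m else 0.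

(** Coefficients of exp(c \sum_n a_{-n} z^n / n). *)
HB.lock Definition creation_series (F : fieldType) (c : F) (m : nat) : fock F :=
  exp_creation fsum aL c (const_series 1) m%:Z.

Section CreationInstances.

Variables (F : fieldType) (F0 : char0 F).
Implicit Types (v w : fock F) (u : dual_fock F) (c : F).

Lemma aL_neg_linear i : linear (@aL F (- i.+1%:Z)).
Proof. exact: aL_linear. Qed.

Lemma aL_neg_comm i j v :
  aL (- i.+1%:Z) (aL (- j.+1%:Z) v) = aL (- j.+1%:Z) (aL (- i.+1%:Z) v).
Proof. exact: (aL_negC i j v). Qed.

Lemma aR_neg_linear i : linear (@aR F (- i.+1%:Z)).
Proof.
move=> c u u'; apply/funext => m.
rewrite -[LHS]/(_%:R * (c * u (mulcm m (ucm i)) + u' (mulcm m (ucm i)))).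
by rewrite mulrDr mulrCA.
Qed.

Lemma aR_neg_comm i j u :
  aR (- i.+1%:Z) (aR (- j.+1%:Z) u) = aR (- j.+1%:Z) (aR (- i.+1%:Z) u).
Proof.
apply/funext => m; rewrite -!NegzE /= !mulrA -!natrM mulcmAC !mulcmE !ucmE [j == i]eq_sym.
have [->//|ij] := eqVneq i j; rewrite !addn0; congr (_%:R * _).
by rewrite mulnC.
Qed.

Lemma newton_creation_series c :
  newton (fun i => c *: creator F i) (creation_series c).
Proof.
have [_ h0 hS] := exp_creation_const F0 c (@fsum_summation _) aL_neg_linear aL_neg_comm 1.
rewrite creation_series.unlock; split=> [|m]; first exact: h0.
rewrite hS; apply: eq_bigr => i _.
by rewrite -NegzE aL_creator scalerAl.
Qed.

Definition creation_mul c v : int -> fock F :=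
  fun k => int_ext (creation_series c) k * v.

Lemma creation_mul_linear c : linear (creation_mul c).
Proof.
move=> a v w; apply/funext => k.
by rewrite /creation_mul -[RHS]/(a *: (_ * v) + _ * w) mulrDr scalerAr.
Qed.

Lemma exp_creation_left_const c v :
  exp_creation fsum aL c (const_series v) = creation_mul c v.
Proof.
have [hN h0 hS] := exp_creation_const F0 c (@fsum_summation _) aL_neg_linear aL_neg_comm v.
have [g0 gS] := newton_creation_series c.
apply/funext => -[m|m]; last by rewrite hN // /creation_mul mul0r.
rewrite /creation_mul /=.
have [n] := ubnP m; elim: n m => // n IH [|m] lt_m; first by rewrite h0 g0 mul1r.
apply: (can_inj (scalerK (F0 m))); rewrite !scaler_nat hS -mulrnAl gS.
rewrite mulr_suml; apply: eq_bigr => i _.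
by rewrite IH -?NegzE ?aL_creator ?scalerAl ?mulrA //; lia.
Qed.

(** The right action of the exponential is adjoint to the multiplication by the
    same polynomials: both sides satisfy Newton's recursion. *)
Lemma exp_creation_right_const c u k v :
  pairing (exp_creation (pwsum fsum) aR c (const_series u) k) v =
  pairing u (creation_mul c v k).
Proof.
have sS := pwsum_summation (T := {cmonom nat}) (@fsum_summation F^o).
have [hN h0 hS] := exp_creation_const F0 c sS aR_neg_linear aR_neg_comm u.
have [g0 gS] := newton_creation_series c.
have pr0 : pairing u 0 = 0 by rewrite /pairing msupp0 big_seq_fset0.
case: k => m; last first.
  rewrite hN // /creation_mul mul0r pr0.
  by rewrite /pairing big1 // => m' _; rewrite mulr0 mul0r.
rewrite /creation_mul /=.
have [n] := ubnP m; elim: n m v => // n IH [|m] v lt_m; first by rewrite h0 g0 mul1r.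
have lp w : linear (fun u => pairing u w : F^o) by exact: pairing_linearl.
have lr : linear (pairing u : fock F -> F^o) by exact: pairing_linear.
apply: (mulfI (F0 m)).
rewrite -[LHS]/(m.+1%:R *: (pairing _ v : F^o)) -(linZ (lp v)) scaler_nat hS.
rewrite -[RHS]/(m.+1%:R *: (pairing u _ : F^o)) -(linZ lr) scaler_nat -mulrnAl gS.
rewrite mulr_suml (lin_sum _ _ (lp v)) (lin_sum _ _ lr); apply: eq_bigr => i _.
rewrite (linZ (lp v)) pairing_aR -NegzE aL_creator IH; last lia.
by rewrite -!scalerAl (linZ lr) mulrCA mulrA.
Qed.

(** The exponential is multiplication by a series in z, hence it commutes with
    the multiplication by z + z^{-1}. *)
Lemma exp_creation_laurent c P :
  exp_creation fsum aL c (laurent const_series P) = laurent (creation_mul c) P.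
Proof.
have lc := @const_series_linear F; have lm := creation_mul_linear c.
suff [k0 [_ ->]] : exists k0, vanish_below k0 (laurent const_series P) /\
    exp_creation fsum aL c (laurent const_series P) = laurent (creation_mul c) P by [].
elim/poly_ind: P => [|P v [k0 [vP IH]]].
  exists 0; rewrite !laurent0; split => //; rewrite -[X in exp_creation _ _ _ X](lin0 lc).
  by rewrite exp_creation_left_const (lin0 lm).
have vX : vanish_below (k0 - 1) (laurent const_series (P * 'X)).
  by move=> k kk; rewrite laurentMX // /sym_shift !vP ?addr0 //; lia.
have vC : vanish_below 0 (laurent const_series v%:P).
  by move=> k kk; rewrite laurentC // /const_series ifF //; lia.
(* a common lower bound for the degrees of P * 'X and of the constant v *)
pose k1 := Num.min (k0 - 1) 0.
have vX1 : vanish_below k1 (laurent const_series (P * 'X)).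
  by move=> k kk; apply: vX; rewrite /k1 in kk; lia.
have vC1 : vanish_below k1 (laurent const_series v%:P).
  by move=> k kk; apply: vC; rewrite /k1 in kk; lia.
exists k1; rewrite !laurentD //; split.
  by move=> k kk; rewrite -[LHS]/(laurent const_series (P * 'X) k +
    laurent const_series v%:P k) vX1 ?vC1 ?addr0.
rewrite (exp_creationD c (@fsum_summation _) aL_neg_linear vX1 vC1).
rewrite !laurentMX // !laurentC // exp_creation_left_const.
by rewrite (exp_creation_sym_shift _ (@fsum_summation _) aL_neg_linear vP) IH.
Qed.

(** The factor 1 - z^2 of W(z) is the difference of the two coefficients. *)
Lemma W_laurent k v : W (- k) v =
  laurent (creation_mul 1) (laurent_eval (- 1) v) k -
  laurent (creation_mul 1) (laurent_eval (- 1) v) (k - 2).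
Proof.
by rewrite /W exp_annihilation_left // exp_creation_laurent opprK.
Qed.

Lemma pairing_Wstar n u v : pairing (Wstar n u) v =
  pairing u (laurent (creation_mul (- 1)) (laurent_eval 1 v) n).
Proof.
have lr : linear (pairing u : fock F -> F^o) by exact: pairing_linear.
rewrite /Wstar exp_annihilation_right //.
rewrite [RHS](laurent_comp _ _ lr (creation_mul_linear _)).
have -> // : (fun w k => pairing (exp_creation (pwsum fsum) aR (- 1) (const_series u) k) w) =
  (fun w k => pairing u (creation_mul (- 1) w k)) :> (fock F -> int -> F^o).
by apply/funext => w; apply/funext => k; rewrite exp_creation_right_const.
Qed.

End CreationInstances.

(** * Determinants *)

Section ColumnOperations.

Variable A : comNzRingType.

(** A column may receive a combination of the preceding ones: this is the
    multiplication by a unitriangular matrix. *)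
Lemma det_col_ops n (m m' : 'I_n -> nat -> A) (c : nat -> nat -> A) :
    (forall i j, (j < n)%N -> m' i j = m i j + \sum_(k < j) c j k * m i k) ->
  \det (\matrix_(i < n, j < n) m' i j) = \det (\matrix_(i < n, j < n) m i j).
Proof.
move=> m'E; pose Z : 'M[A]_n :=
  \matrix_(k, j) (if (k < j)%N then c j k else (k == j)%:R).
have detZ : \det Z = 1.
  rewrite -det_tr det_trig; first by rewrite big1 // => i _; rewrite !mxE ltnn eqxx.
  apply/is_trig_mxP => i j ij; rewrite !mxE ltnNge (ltnW ij) /=.
  by case: eqP => // ji; rewrite ji ltnn in ij.
rewrite -[RHS]mulr1 -detZ -det_mulmx; congr (\det _); apply/matrixP => i j.
rewrite !mxE m'E // addrC.
rewrite (bigID (fun k : 'I_n => (k < j)%N)) /=; congr (_ + _).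
  rewrite (big_ord_widen_cond n predT (fun k => c j k * m i k)) 1?ltnW //.
  by apply: eq_bigr => k /= kj; rewrite !mxE kj mulrC.
rewrite (bigD1 j) ?ltnn //= big1 ?addr0; first by rewrite !mxE ltnn eqxx mulr1.
by move=> k /andP[/negPf kj /negPf ne]; rewrite !mxE kj ne mulr0.
Qed.

(** Three-term column operations from column r on.  Column r+1 has no second
    predecessor to receive: in the recursion that governs the columns, that
    term would be 0. *)
Lemma det_three_term n r (s : A) (m m' : 'I_n -> nat -> A) :
    (forall i j, (j <= r)%N -> m' i j = m i j) ->
    (forall i, m' i r.+1 = m i r.+1 - s * m i r) ->
    (forall i j, (r < j)%N -> m' i j.+1 = m i j.+1 - s * m i j + m i j.-1) ->
  \det (\matrix_(i < n, j < n) m' i j) = \det (\matrix_(i < n, j < n) m i j).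
Proof.
move=> m'le m'r m'gt.
(* coefficient with which column k enters column j *)
pose c j k : A := if (j <= r)%N then 0 else if k.+1 == j then - s else
  ((k.+2 == j) && (r < k.+1)%N)%:R.
apply: (@det_col_ops _ _ _ c) => i j _; rewrite /c.
have [jr|rj] := leqP j r.
  by rewrite m'le // big1 ?addr0 // => k _; rewrite mul0r.
case: j rj => // j; rewrite ltnS leq_eqVlt => /predU1P[<-|rj].
  rewrite m'r big_ord_recr /= eqxx mulNr big1 ?add0r // => k _.
  rewrite ifF; last by case: k => /= k; lia.
  by rewrite (_ : (_ && _) = false) ?mul0r //; case: k => /= k; lia.
rewrite m'gt // big_ord_recr /= eqxx mulNr -addrA; congr (_ + _).
rewrite addrC; congr (_ + _); case: j rj => // j rj.
rewrite big_ord_recr /= eqxx rj ifF ?mul1r; last lia.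
rewrite big1 ?add0r // => k _; rewrite ifF; last by case: k => /= k; lia.
by rewrite (_ : (_ && _) = false) ?mul0r //; case: k => /= k; lia.
Qed.

(** The determinant is linear in row i0 over the ring of the other entries, so
    a map that is linear over that ring can be applied to row i0 alone. *)
Lemma linear_det_row n (i0 : 'I_n) (Psi : {poly A} -> A) (b : 'I_n -> {poly A})
    (M : 'M[A]_n) :
    {morph Psi : p q / p + q} -> Psi 0 = 0 ->
    (forall p a, Psi (p * a%:P) = Psi p * a) ->
  Psi (\det (\matrix_(i, j) if i == i0 then b j else (M i j)%:P)) =
  \det (\matrix_(i, j) if i == i0 then Psi (b j) else M i j).
Proof.
move=> PsiD Psi0 PsiM; rewrite !(expand_det_row _ i0) (big_morph _ PsiD Psi0).
apply: eq_bigr => j _; rewrite !mxE eqxx.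
suff -> : cofactor (\matrix_(i, j) if i == i0 then b j else (M i j)%:P) i0 j =
  (cofactor (\matrix_(i, j) if i == i0 then Psi (b j) else M i j) i0 j)%:P by [].
rewrite -cofactor_map_mx /cofactor; congr (_ * \det _).
by apply/matrixP => i k; rewrite !mxE [lift _ _ == _]eq_sym (negPf (neq_lift _ _)).
Qed.

Lemma linear_det_col n (j0 : 'I_n) (Psi : {poly A} -> A) (b : 'I_n -> {poly A})
    (M : 'M[A]_n) :
    {morph Psi : p q / p + q} -> Psi 0 = 0 ->
    (forall p a, Psi (p * a%:P) = Psi p * a) ->
  Psi (\det (\matrix_(i, j) if j == j0 then b i else (M i j)%:P)) =
  \det (\matrix_(i, j) if j == j0 then Psi (b i) else M i j).
Proof.
move=> PsiD Psi0 PsiM; have := linear_det_row j0 b M^T PsiD Psi0 PsiM.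
rewrite -det_tr -[\det (\matrix_(i, j) _) in RHS]det_tr => eq_det.
rewrite (_ : (\matrix_(i, j) if j == j0 then b i else _) =
  (\matrix_(i, j) if i == j0 then b j else (M^T i j)%:P)^T); last first.
  by apply/matrixP => i j; rewrite !mxE.
rewrite eq_det; congr (\det _); apply/matrixP => i j; rewrite !mxE //.
Qed.

End ColumnOperations.

(** * The determinant of a ket *)

Section DeterminantSteps.

Variable A : comNzRingType.

(** The entries of all the determinants; they are odd in j. *)
Definition o_entry (B : zmodType) (h : int -> B) (M j : int) : B := h (M + j) - h (M - j).

Lemma o_entry0 (B : zmodType) (h : int -> B) M : o_entry h M 0 = 0.
Proof. by rewrite /o_entry oppr0 subrr. Qed.

Lemma o_entry_three_term (h g : int -> {poly A}) M j :
    (forall m, g m = h m - 'X * h (m - 1) + h (m - 2)) ->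
  o_entry g M j =
  o_entry h (M - 1) (j + 1) - 'X * o_entry h (M - 1) j + o_entry h (M - 1) (j - 1).
Proof.
move=> gE; rewrite /o_entry !gE.
have e1 : M - 1 + (j + 1) = M + j by lia.
have e2 : M - 1 - (j + 1) = M - j - 2 by lia.
have e3 : M - 1 + j = M + j - 1 by lia.
have e4 : M - 1 - j = M - j - 1 by lia.
have e5 : M - 1 + (j - 1) = M + j - 2 by lia.
have e6 : M - 1 - (j - 1) = M - j by lia.
by rewrite e1 e2 e3 e4 e5 e6; ring.
Qed.

(** (z^{j+1} - z^{-j-1}) / (z - z^{-1}) as a polynomial in z + z^{-1}: the
    Chebyshev polynomials of the second kind, up to scaling.  Their recursion
    is the one of the column operations, which therefore clear a row of them. *)
Fixpoint chebU (j : nat) : {poly A} :=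
  if j is j'.+1 then
    if j' is k.+1 then chebU j' * 'X - chebU k else 'X
  else 1.

Definition ket_det (h : int -> A) (lam : seq nat) : A :=
  \det (\matrix_(i < size lam, j < size lam)
    o_entry h ((nth 0%N lam i)%:Z - i.+1%:Z) j.+1%:Z).

Section KetStep.

Variables (h : int -> A) (theta : {rmorphism A -> {poly A}}).
Variable Psi : int -> {poly A} -> A.
Hypothesis theta_h : forall m, theta (h m) = (h m)%:P - 'X * (h (m - 1))%:P + (h (m - 2))%:P.
Hypothesis PsiD : forall k, {morph Psi k : p q / p + q}.
Hypothesis Psi0 : forall k, Psi k 0 = 0.
Hypothesis PsiM : forall k p a, Psi k (p * a%:P) = Psi k p * a.
Hypothesis PsiX : forall k p, Psi k (p * 'X) = Psi (k + 1) p + Psi (k - 1) p.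
Hypothesis Psi1 : forall k, Psi k 1 = h k.

(** (1 - z^2) times the j-th polynomial is z^{-j} - z^{j+2}, and Psi k is the
    coefficient of z^k in the product with \sum_m h_m z^m. *)
Lemma Psi_chebU k j :
  Psi k (chebU j) - Psi (k - 2) (chebU j) = o_entry h (k - 1) j.+1%:Z.
Proof.
have PsiN k' p : Psi k' (- p) = - Psi k' p.
  by apply/eqP; rewrite -addr_eq0 -PsiD addNr Psi0.
have [n] := ubnP j; elim: n j k => // n IH [|[|j]] k lt_j.
- rewrite /= !Psi1 /o_entry; congr (h _ - h _); lia.
- rewrite /= -['X]mul1r !PsiX !Psi1 /o_entry.
  have -> : k - 2 + 1 = k - 1 by lia.
  have -> : k - 1 + 2%:Z = k + 1 by lia.
  have -> : k - 1 - 2%:Z = k - 2 - 1 by lia.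
  by ring.
rewrite /= -/(chebU j.+1) !PsiD !PsiN !PsiX.
transitivity ((Psi (k + 1) (chebU j.+1) - Psi (k + 1 - 2) (chebU j.+1)) +
    (Psi (k - 1) (chebU j.+1) - Psi (k - 1 - 2) (chebU j.+1)) -
    (Psi k (chebU j) - Psi (k - 2) (chebU j))).
  have -> : k - 1 - 2 = k - 2 - 1 by lia.
  have -> : k + 1 - 2 = k - 2 + 1 by lia.
  by ring.
rewrite !IH; try lia; rewrite /o_entry.
have -> : k - 1 - 1 + j.+2%:Z = k - 1 + j.+1%:Z by lia.
have -> : k + 1 - 1 - j.+2%:Z = k - 1 - j.+1%:Z by lia.
have -> : k + 1 - 1 + j.+2%:Z = k - 1 + j.+3%:Z by lia.
have -> : k - 1 - 1 - j.+2%:Z = k - 1 - j.+3%:Z by lia.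
by ring.
Qed.

(** Adding a part in front of a partition.  Theta of the old determinant is
    bordered by a row of Chebyshev polynomials, after which s occurs in that
    row only and Psi is applied to it alone. *)
Lemma ket_det_step (k : nat) lam :
  Psi k%:Z (theta (ket_det h lam)) - Psi (k%:Z - 2) (theta (ket_det h lam)) =
  ket_det h (k :: lam).
Proof.
set n := size lam; pose lambda i := nth 0%N lam i.
(* the additional 1 accounts for the old row i being the new row i+1 *)
pose Mrow i : int := (lambda i)%:Z - i.+1%:Z - 1.
pose coef (i : 'I_n.+1) (j : 'I_n.+1) : A :=
  if unlift ord0 i is Some i' then o_entry h (Mrow i') j.+1%:Z else 0.
pose bordered := \matrix_(i < n.+1, j < n.+1)
  if i == ord0 then chebU j else (coef i j)%:P.
have bordered_det : \det bordered = theta (ket_det h lam).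
  pose m (i : 'I_n.+1) (j : nat) : {poly A} :=
    if unlift ord0 i is Some i' then (o_entry h (Mrow i') j.+1%:Z)%:P else chebU j.
  pose m' (i : 'I_n.+1) (j : nat) : {poly A} :=
    if unlift ord0 i is Some i' then
      if j is j'.+1 then theta (o_entry h (Mrow i' + 1) j'.+1%:Z)
      else (o_entry h (Mrow i') 1)%:P
    else (j == 0%N)%:R.
  have theta_entry M j : theta (o_entry h (M + 1) j.+1%:Z) =
      (o_entry h M j.+2%:Z)%:P - 'X * (o_entry h M j.+1%:Z)%:P + (o_entry h M j%:Z)%:P.
    have := @o_entry_three_term (polyC \o h) (theta \o h) (M + 1) j.+1%:Z theta_h.
    rewrite /o_entry /= !rmorphB => ->.
    by congr (_ - _ - 'X * (_ - _) + (_ - _)); congr (_%:P); congr h; lia.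
  have -> : bordered = \matrix_(i < n.+1, j < n.+1) m i j.
    apply/matrixP => i j; rewrite !mxE /coef /m.
    by case: unliftP => [i' ->|->]; rewrite ?eqxx // eq_sym (negPf (neq_lift _ _)).
  rewrite -(@det_three_term _ _ 0 'X m m'); first last.
  - move=> i [//|j] _; rewrite /m' /m; case: unliftP => [i' _|_].
      exact: theta_entry.
    by rewrite /= -/(chebU j.+1) mulrC; ring.
  - move=> i; rewrite /m' /m; case: unliftP => [i' _|_]; last by rewrite /= mulr1 subrr.
    by rewrite (theta_entry (Mrow i') 0) o_entry0 addr0.
  - by move=> i [|//] _; rewrite /m' /m; case: unliftP.
  rewrite (expand_det_row _ ord0) big_ord_recl big1 ?addr0 => [|j _]; last first.
    by rewrite !mxE /m' unlift_none /= mul0r.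
  rewrite !mxE /m' unlift_none mul1r /cofactor addn0 expr0 mul1r -det_map_mx.
  congr (\det _); apply/matrixP => i j; rewrite !mxE liftK /=; congr (theta (o_entry h _ _)).
  by rewrite /Mrow subrK.
rewrite -bordered_det.
pose PsiB p := Psi k%:Z p - Psi (k%:Z - 2) p.
have linB := @linear_det_row A n.+1 ord0 PsiB (fun j => chebU j) (\matrix_(i, j) coef i j).
rewrite -[LHS]/(PsiB _).
have -> : bordered = \matrix_(i < n.+1, j < n.+1)
    if i == ord0 then chebU j else ((\matrix_(i, j) coef i j) i j)%:P.
  by apply/matrixP => i j; rewrite !mxE.
rewrite linB.
- congr (\det _); apply/matrixP => i j; rewrite !mxE /coef.
  case: (unliftP ord0 i) => [i' ->|->]; last first.
    by rewrite eqxx /PsiB Psi_chebU.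
  rewrite eq_sym (negPf (neq_lift _ _)); congr (o_entry h _ _).
  by rewrite /Mrow /lambda lift0 /= -addrA -opprD -PoszD addn1.
- by move=> p q; rewrite /PsiB !PsiD opprD addrACA.
- by rewrite /PsiB !Psi0 subrr.
- by move=> p a; rewrite /PsiB !PsiM mulrBl.
Qed.

End KetStep.

End DeterminantSteps.

(** * Lowering a determinant by a bra *)

Section BraStep.

Variables (K A : comNzRingType) (iota : {rmorphism K -> A}).
Variables (theta : {rmorphism A -> {poly A}}) (e f : nat -> A) (H : nat -> K).
Variable Psi : int -> {poly A} -> A.
Local Notation fZ := (int_ext f).
Local Notation eZ := (int_ext e).
Local Notation HZ := (int_ext H).
Local Notation t := (theta \o fZ).
Hypothesis theta_f : forall m, (fZ m)%:P = t m - 'X * t (m - 1) + t (m - 2).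
Hypothesis theta_iota : forall c, theta (iota c) = (iota c)%:P.
Hypothesis conv_ef : forall m, conv e f m = iota (H m).
Hypothesis PsiD : forall k, {morph Psi k : p q / p + q}.
Hypothesis Psi0 : forall k, Psi k 0 = 0.
Hypothesis PsiM : forall k p a, Psi k (p * a%:P) = Psi k p * a.
Hypothesis PsiX : forall k p, Psi k (p * 'X) = Psi (k + 1) p + Psi (k - 1) p.
Hypothesis Psi1 : forall k, Psi k 1 = eZ k.

Let y (m k : int) : A := Psi k (t m).

(** y m k is the coefficient of w^k in E(w) t_m, with E the series of e; the
    generating series of the t_m in z is that of the f_m divided by
    (1 - w z)(1 - w^{-1} z). *)
Lemma Psi_rec m k :
  y m k = y (m - 1) (k + 1) + y (m - 1) (k - 1) - y (m - 2) k + eZ k * fZ m.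
Proof.
have PsiN k' p : Psi k' (- p) = - Psi k' p.
  by apply/eqP; rewrite -addr_eq0 -PsiD addNr Psi0.
have -> : y m k = Psi k (t (m - 1) * 'X - t (m - 2) + 1 * (fZ m)%:P).
  by rewrite /y; congr (Psi k _); rewrite theta_f; ring.
by rewrite !PsiD PsiN PsiX PsiM Psi1.
Qed.

Lemma Psi_neg m k : m < 0 -> y m k = 0.
Proof. by case: m => // m _; rewrite /y /= rmorph0 Psi0. Qed.

(** Multiplication by 1 - w^{-1} z cancels the only source of negative powers
    of w, as E(w) has none. *)
Lemma Psi_shift_neg m k : k < 0 -> y m k = y (m - 1) (k + 1).
Proof.
case: m => m; last by move=> _; rewrite !Psi_neg //; lia.
elim: m k => [|m IH] k k0; rewrite Psi_rec.
  rewrite (Psi_neg (k - 1)) ?(Psi_neg k) //; try lia.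
  by case: k k0 => // k _; rewrite /= mul0r oppr0 !addr0.
have -> : m.+1%:Z - 1 = m%:Z by lia.
have -> : m.+1%:Z - 2 = m%:Z - 1 by lia.
rewrite (IH (k - 1)); last lia.
rewrite subrK; case: k k0 => // k _; rewrite /= mul0r addr0.
by rewrite addrK.
Qed.

(** Multiplication by 1 - w z cancels the other factor. *)
Lemma Psi_shift (m : nat) k : y m%:Z k - y (m%:Z - 1) (k - 1) =
  \sum_(b < m.+1) eZ (k + b%:Z) * f (m - b).
Proof.
elim: m k => [|m IH] k.
  rewrite big_ord1 addr0 subn0 Psi_rec !(@Psi_neg (0 - 1)) // (@Psi_neg (0 - 2)) //.
  by rewrite !(addr0, oppr0, add0r).
rewrite big_ord_recl addr0 subn0 Psi_rec.
have -> : m.+1%:Z - 1 = m%:Z by lia.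
have -> : m.+1%:Z - 2 = m%:Z - 1 by lia.
have := IH (k + 1); rewrite addrK => eqIH.
transitivity (y m%:Z (k + 1) - y (m%:Z - 1) k + eZ k * f m.+1).
  by rewrite /=; ring.
rewrite eqIH addrC; congr (_ + _); apply: eq_bigr => b _; congr (eZ _ * f _).
  by rewrite lift0; lia.
Qed.

(** For nonpositive exponents Psi_shift_neg reduces to the coefficient of w^0,
    where the difference t_{m} - t_{m-2} has the same coefficient as
    t_m - w t_{m-1}; the latter is the convolution of e and f. *)
Lemma Psi_first_column (k : nat) M : Psi (- k%:Z) (o_entry t M 1) = iota (HZ (M + 1 - k%:Z)).
Proof.
have PsiN k' p : Psi k' (- p) = - Psi k' p.
  by apply/eqP; rewrite -addr_eq0 -PsiD addNr Psi0.
have y_neg m : y m (- k%:Z) = y (m - k%:Z) 0.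
  elim: k m => [|k IH] m; first by congr (y _ _); lia.
  rewrite Psi_shift_neg; last lia.
  have -> : - k.+1%:Z + 1 = - k%:Z by lia.
  by rewrite IH; congr (y _ _); lia.
rewrite /o_entry PsiD PsiN -!/(y _ _) !y_neg.
have -> : M - 1 - k%:Z = M + 1 - k%:Z - 1 - 1 by lia.
rewrite -{2}[0](@addNr int 1) -Psi_shift_neg //.
case: (M + 1 - k%:Z) => n; last by rewrite !Psi_neg ?subr0 //= rmorph0.
rewrite -[- 1]add0r Psi_shift /= -conv_ef; apply: eq_bigr => b _.
by rewrite ?add0r.
Qed.

(** What r operators W^* make of the determinant of a ket. *)
Definition bra_det n r (q : 'I_n -> nat -> K) (m : 'I_n -> int) : A :=
  \det (\matrix_(i < n, j < n)
    if (j < r)%N then iota (q i j) else o_entry fZ (m i + r%:Z) (j - r).+1%:Z).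

(** After undoing the substitution theta by column operations, w + w^{-1}
    occurs in column r only. *)
Lemma bra_det_step n r q (m : 'I_n -> int) (k : nat) : (r < n)%N ->
  Psi (- k%:Z) (theta (bra_det r q m)) =
  bra_det r.+1 (fun i j => if j == r then HZ (m i + r.+1%:Z - k%:Z) else q i j) m.
Proof.
move=> rn; rewrite /bra_det -det_map_mx.
pose c (i : 'I_n) (j : nat) : {poly A} :=
  if (j < r)%N then (iota (q i j))%:P else o_entry t (m i + r%:Z) (j - r).+1%:Z.
(* c after the column operations *)
pose c' (i : 'I_n) (j : nat) : {poly A} :=
  if (j < r)%N then (iota (q i j))%:P else
  if j == r then o_entry t (m i + r%:Z) 1
  else (o_entry fZ (m i + r.+1%:Z) (j - r)%:Z)%:P.
have -> : map_mx theta (\matrix_(i < n, j < n)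
    if (j < r)%N then iota (q i j) else o_entry fZ (m i + r%:Z) (j - r).+1%:Z) =
    \matrix_(i < n, j < n) c i j.
  apply/matrixP => i j; rewrite !mxE /c; case: ifP => _ //.
  by rewrite /o_entry rmorphB.
have f_entry M j : (o_entry fZ (M + 1) j%:Z)%:P =
    o_entry t M (j.+1)%:Z - 'X * o_entry t M j%:Z + o_entry t M (j%:Z - 1).
  have := @o_entry_three_term A t (polyC \o fZ) (M + 1) j%:Z theta_f.
  rewrite /o_entry /= rmorphB => ->.
  by congr (_ - _ - 'X * (_ - _) + (_ - _)); congr (theta (fZ _)); lia.
have eMr i : m i + r.+1%:Z = m i + r%:Z + 1 by lia.
rewrite -(@det_three_term _ _ r 'X c c'); first last.
- move=> i [//|j]; rewrite ltnS => rj; rewrite /c' /c !ifF; try lia.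
  rewrite eMr /= !subSn ?(leqW rj) // f_entry; congr (_ + o_entry _ _ _); lia.
- move=> i; rewrite /c' /c !ifF; try lia.
  by rewrite eMr subSnn subnn f_entry subrr o_entry0 addr0.
- move=> i j jr; rewrite /c' /c; case: ltnP => // rj.
  by rewrite (anti_leq (introT andP (conj jr rj))) eqxx subnn.
pose j0 := Ordinal rn.
pose M : 'M[A]_n := \matrix_(i, j) if (j < r)%N then iota (q i j) else
  o_entry fZ (m i + r.+1%:Z) (j - r)%:Z.
have -> : \matrix_(i < n, j < n) c' i j = \matrix_(i, j)
    if j == j0 then o_entry t (m i + r%:Z) 1 else (M i j)%:P.
  apply/matrixP => i j; rewrite !mxE /c' -val_eqE /=.
  case: (ltngtP j r) => [jr|rj|jr] //.
rewrite linear_det_col; [|exact: PsiD|exact: Psi0|exact: PsiM].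
congr (\det _); apply/matrixP => i j; rewrite !mxE -val_eqE /= ltnS.
case: (ltngtP j r) => [jr|rj|jr] //.
  by rewrite subnSK.
rewrite Psi_first_column; congr (iota (HZ _)); lia.
Qed.

End BraStep.

(** * Three-term relations and h_n(x^{+-}) *)

Section Quadratic.

Variable A : comNzRingType.

(** (1 - z t)(1 - z^{-1} t) = 1 - s t + t^2, as a series in t. *)
Definition quadratic (m : nat) : {poly A} :=
  match m with 0 => 1 | 1 => - 'X | 2 => 1 | _ => 0 end.

Lemma newton_quadratic : newton (fun i => - power_sum2 A i.+1) quadratic.
Proof.
split=> // -[|[|m]]; first by rewrite big_ord1 /= mulr1n mulr1.
  by rewrite big_ord_recr big_ord1 /= mulr1 mulrNN opprB addrCA subrr addr0.
rewrite -(big_mkord xpredT (fun i => - power_sum2 A i.+1 * quadratic (m.+2 - i))).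
rewrite !big_nat_recr // big_nat big1 => [|i /andP[_ im]]; last first.
  have -> : (m.+2 - i = (m - i.+1).+3)%N by lia.
  exact: mulr0.
have [-> -> ->] : [/\ m.+2 - m = 2, m.+2 - m.+1 = 1 & m.+2 - m.+2 = 0]%N by split; lia.
by rewrite /= -/(power_sum2 A m.+1) mul0rn; ring.
Qed.

Lemma conv_quadratic g g' : g' =1 conv quadratic g ->
  forall m, int_ext g' m = int_ext g m - 'X * int_ext g (m - 1) + int_ext g (m - 2).
Proof.
move=> g'E [m|m]; last first.
  have -> : Negz m - 1 = Negz m.+1 by lia.
  have -> : Negz m - 2 = Negz m.+2 by lia.
  by rewrite /= mulr0 subrr addr0.
rewrite [LHS]/= g'E /conv; case: m => [|[|m]].
- by rewrite big_ord1 /=; ring.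
- by rewrite big_ord_recr big_ord1 /= subnn; ring.
have -> : m.+2%:Z - 1 = m.+1%:Z by lia.
have -> : m.+2%:Z - 2 = m%:Z by lia.
rewrite !big_ord_recl big1 => [|i _]; last by rewrite /= mul0r.
by rewrite /= /bump /= !add1n subn0 subn1 subn2 /=; ring.
Qed.

End Quadratic.

Lemma int_ext_morph (V W : nmodType) (f : V -> W) h m : f 0 = 0 ->
  f (int_ext h m) = int_ext (f \o h) m.
Proof. by case: m. Qed.

Lemma newton_ext (A : comNzRingType) (p p' h h' : nat -> A) :
  newton p h -> p =1 p' -> h =1 h' -> newton p' h'.
Proof. by move=> nh /funext <- /funext <-. Qed.

Section SymmetricFunctions.

Variables (F : fieldType) (N : nat) (x : 'I_N -> F).

Definition power_sum_pm (i : nat) : F := \sum_(j < N) (x j ^+ i.+1 + (x j)^-1 ^+ i.+1).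

Lemma newton_geometric (y : F) : newton (fun i => y ^+ i.+1) (fun m => y ^+ m).
Proof.
split=> // m; rewrite (eq_bigr (fun=> y ^+ m.+1)) ?sumr_const ?card_ord // => i _.
by rewrite -exprD; congr (_ ^+ _); case: i => /= i; lia.
Qed.

Definition h_nat (m : nat) : F := h_pm x m%:Z.

Lemma h_pm_int m : h_pm x m = int_ext h_nat m.
Proof. by case: m. Qed.

(** h_n(x^{+-}) is the convolution of the 2N geometric sequences, and power
    sums add up. *)
Lemma newton_h_pm : newton power_sum_pm h_nat.
Proof.
pose geo n (y : F) := \poly_(k < n) y ^+ k.
pose G s : nat -> F := foldr (fun i g =>
    conv (conv (fun m => x i ^+ m) (fun m => (x i)^-1 ^+ m)) g)
  (fun m => (m == 0%N)%:R) s.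
have GE n s m : (m < n)%N ->
    (\prod_(i <- s) (geo n (x i) * geo n (x i)^-1))`_m = G s m.
  elim: s m => [|i s IH] m mn; first by rewrite big_nil coef1.
  rewrite big_cons coefM; apply: eq_bigr => a _.
  rewrite IH; last by case: a => /= a; lia.
  congr (_ * _); rewrite coef_trunc_polyM //; case: a => /= a; lia.
have nG s : newton (fun m => \sum_(j <- s) (x j ^+ m.+1 + (x j)^-1 ^+ m.+1)) (G s).
  elim: s => [|i s IH].
    split=> // m; rewrite mul0rn big1 // => i _; by rewrite big_nil mul0r.
  apply: newton_ext (newton_conv (newton_conv (newton_geometric (x i))
    (newton_geometric (x i)^-1)) IH) _ _ => // m.
  by rewrite big_cons.
apply: newton_ext (nG (index_enum 'I_N)) _ _ => // m.
by rewrite -(GE m.+1).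
Qed.

End SymmetricFunctions.

(** * Matrix coefficients of vertex operators *)

Section MainProof.

Variables (F : fieldType) (F0 : char0 F).
Local Notation hZ := (int_ext (creation_series 1 : nat -> fock F)).
Local Notation eZ := (int_ext (creation_series (- 1) : nat -> fock F)).

Lemma fock_torsion_free : torsion_free (fock F).
Proof. exact: torsion_free_alg. Qed.

Lemma newton_h : newton (creator F) (creation_series 1).
Proof.
by apply: newton_ext (newton_creation_series F0 1) _ _ => // i; rewrite scale1r.
Qed.

Lemma newton_e : newton (fun i => - creator F i) (creation_series (- 1)).
Proof.
by apply: newton_ext (newton_creation_series F0 (- 1)) _ _ => // i; rewrite scaleN1r.
Qed.

Lemma newton_laurent_eval c (p h : nat -> fock F) : newton p h ->
  newton (fun i => laurent_eval c (p i)) (fun m => laurent_eval c (h m)).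
Proof. exact: (@newton_rmorph (fock F) {poly fock F} (laurent_eval c) p h). Qed.

Lemma newton_polyC (p h : nat -> fock F) : newton p h ->
  newton (fun i => (p i)%:P) (fun m => (h m)%:P).
Proof. exact: (@newton_rmorph (fock F) {poly fock F} polyC p h). Qed.

Lemma newton_shift_eval s (p h : nat -> fock F) : newton p h ->
  newton (fun i => shift_eval s (p i)) (fun m => shift_eval s (h m)).
Proof. exact: (@newton_rmorph (fock F) (fock F) (shift_eval s) p h). Qed.

(** The coefficient of z^k in exp(c \sum_n a_{-n} z^n / n) P(z + z^{-1}). *)
Definition laurent_mul c k : {poly fock F} -> fock F := laurent (creation_mul c) ^~ k.

Lemma laurent_mulD c k : {morph laurent_mul c k : p q / p + q}.
Proof. by move=> p q; rewrite /laurent_mul laurentD //; apply: creation_mul_linear. Qed.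

Lemma laurent_mul0 c k : laurent_mul c k 0 = 0.
Proof. by rewrite /laurent_mul laurent0. Qed.

Lemma laurent_mulM c k p a : laurent_mul c k (p * a%:P) = laurent_mul c k p * a.
Proof.
have lc := @creation_mul_linear F c.
have la : linear (fun w : fock F => w * a) by move=> b v w; rewrite mulrDl scalerAl.
have eqG : (fun w => creation_mul c (a * w)) =
    (fun w k => creation_mul c w k * a) :> (fock F -> int -> fock F).
  by apply/funext => w; apply/funext => j; rewrite /creation_mul [a * w]mulrC mulrA.
rewrite /laurent_mul mulrC (laurentMC _ _ lc) eqG.
exact: (esym (laurent_comp p k la lc)).
Qed.

Lemma laurent_mulX c k p : laurent_mul c k (p * 'X) =
  laurent_mul c (k + 1) p + laurent_mul c (k - 1) p.
Proof. by rewrite /laurent_mul laurentMX //; apply: creation_mul_linear. Qed.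

Lemma laurent_mul1 c k : laurent_mul c k 1 = int_ext (creation_series c) k.
Proof.
rewrite /laurent_mul -polyC1 laurentC /creation_mul ?mulr1 //.
exact: creation_mul_linear.
Qed.

Lemma laurent_eval_int c (g : nat -> fock F) m :
  laurent_eval c (int_ext g m) = int_ext (fun k => laurent_eval c (g k)) m.
Proof. by case: m => //= m; rewrite rmorph0. Qed.

Lemma polyC_int (g : nat -> fock F) m :
  (int_ext g m)%:P = int_ext (fun k => (g k)%:P) m.
Proof. by case: m. Qed.

Lemma laurent_eval_h m : laurent_eval (- 1) (hZ m) =
  (hZ m)%:P - 'X * (hZ (m - 1))%:P + (hZ (m - 2))%:P.
Proof.
pose p i : {poly fock F} := - power_sum2 (fock F) i.+1 + (creator F i)%:P.
have nl : newton p (fun m => laurent_eval (- 1) (creation_series 1 m)).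
  apply: (newton_ext (newton_laurent_eval (- 1) newton_h) _ (fun=> erefl)) => i.
  by rewrite laurent_eval_creator scaleN1r polyCN polyC1 mulN1r addrC.
have nr : newton p (conv (quadratic (fock F)) (fun m => (creation_series 1 m)%:P)).
  exact: newton_conv (newton_quadratic (fock F)) (newton_polyC newton_h).
rewrite laurent_eval_int !polyC_int.
exact: conv_quadratic (newton_uniq (torsion_free_poly fock_torsion_free) nl nr) m.
Qed.

Lemma ket_as_det (lam : seq nat) : ket lam = ket_det hZ lam.
Proof.
elim: lam => [|k lam IH]; first by rewrite /ket_det det_mx00.
rewrite -[LHS]/(W (- k%:Z) (ket lam)) IH W_laurent //.
apply: (@ket_det_step _ _ (laurent_eval (- 1 : F)) (laurent_mul 1)).
- exact: laurent_eval_h.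
- exact: laurent_mulD.
- exact: laurent_mul0.
- exact: laurent_mulM.
- exact: laurent_mulX.
- exact: laurent_mul1.
Qed.

Section Skew.

Variables (N : nat) (x : 'I_N -> F).

Lemma shift_eval_comp p q (v : fock F) :
  shift_eval p (shift_eval q v) = shift_eval (fun i => p i + q i) v.
Proof.
elim/fock_ind: v => [|i v IH|c v w IHv IHw].
- by rewrite !shift_eval1.
- rewrite !shift_evalM IH !shift_eval_creator shift_evalD shift_evalZ shift_eval1.
  by rewrite shift_eval_creator scalerDl addrA.
- by rewrite !(shift_evalD, shift_evalZ) IHv IHw.
Qed.

Lemma shift_eval0 (v : fock F) : shift_eval (fun=> 0) v = v.
Proof.
elim/fock_ind: v => [|i v IH|c v w IHv IHw]; first exact: shift_eval1.
  by rewrite shift_evalM IH shift_eval_creator scale0r addr0.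
by rewrite shift_evalD shift_evalZ IHv IHw.
Qed.

Lemma Gamma_plus_pmE v : Gamma_plus_pm x v = shift_eval (power_sum_pm x) v.
Proof.
suff step s : foldr (fun i w => Gamma_plus (x i) (Gamma_plus (x i)^-1 w)) v s =
    shift_eval (fun k => \sum_(j <- s) (x j ^+ k.+1 + (x j)^-1 ^+ k.+1)) v.
  rewrite /Gamma_plus_pm step; congr (shift_eval _ v); apply/funext => k.
  by rewrite /power_sum_pm big_enum.
elim: s => [|i s IH] /=.
  rewrite -[LHS]shift_eval0; congr (shift_eval _ v); apply/funext => k.
  by rewrite big_nil.
rewrite IH !(Gamma_plusE F0) !shift_eval_comp; congr (shift_eval _ v).
by apply/funext => k; rewrite big_cons.
Qed.

Let f m : fock F := shift_eval (power_sum_pm x) (creation_series 1 m).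
Let iota : {rmorphism F -> fock F} := in_alg (fock F).

Lemma newton_f : newton (fun i => creator F i + (power_sum_pm x i)%:A) f.
Proof.
apply: (newton_ext (newton_shift_eval _ newton_h) _ (fun=> erefl)) => i.
by rewrite shift_eval_creator.
Qed.

Lemma laurent_eval_f m : (int_ext f m)%:P =
  laurent_eval 1 (int_ext f m) - 'X * laurent_eval 1 (int_ext f (m - 1)) +
  laurent_eval 1 (int_ext f (m - 2)).
Proof.
pose p i : {poly fock F} := (creator F i + (power_sum_pm x i)%:A)%:P.
have nl : newton p (fun m => (f m)%:P) by exact: newton_polyC newton_f.
have nr : newton p (conv (quadratic (fock F)) (fun m => laurent_eval 1 (f m))).
  apply: (newton_ext (newton_conv (newton_quadratic (fock F))
    (newton_laurent_eval 1 newton_f)) _ (fun=> erefl)) => i.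
  rewrite laurent_evalD laurent_evalZ laurent_eval1 mulr1 laurent_eval_creator /p polyCD.
  by rewrite scale1r polyC1 mul1r -addrA addrCA addKr.
rewrite polyC_int !laurent_eval_int.
exact: conv_quadratic (newton_uniq (torsion_free_poly fock_torsion_free) nl nr) m.
Qed.

Lemma laurent_eval_const c : laurent_eval 1 (c%:A : fock F) = (c%:A)%:P.
Proof. by rewrite laurent_evalZ laurent_eval1 mulr1. Qed.

(** The factor H(z) of the series of f cancels against its inverse. *)
Lemma conv_ef m : conv (creation_series (- 1)) f m = iota (h_nat x m).
Proof.
move: m; apply: newton_uniq.
- exact: fock_torsion_free.
- exact: newton_conv newton_e newton_f.
apply: newton_ext (newton_rmorph iota (newton_h_pm x)) _ _ => // i.
by rewrite /= addKr.
Qed.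

Definition vacuum_coef : fock F -> F := fock_eval idfun (fun=> 0).

HB.instance Definition _ := GRing.RMorphism.on vacuum_coef.

Lemma vacuum_coef_creator i : vacuum_coef (creator F i) = 0.
Proof. exact: fock_eval_creator. Qed.

Lemma vacuum_coefZ c v : vacuum_coef (c *: v) = c * vacuum_coef v.
Proof. exact: fock_evalZ. Qed.

Lemma vacuum_coefD : {morph vacuum_coef : v w / v + w}.
Proof. exact: rmorphD. Qed.

Lemma vacuum_coefM : {morph vacuum_coef : v w / v * w}.
Proof. exact: rmorphM. Qed.

Lemma vacuum_coef1 : vacuum_coef 1 = 1.
Proof. exact: rmorph1. Qed.

Lemma vacuum_coefE v : pairing dual_vac v = vacuum_coef v.
Proof.
elim/fock_ind: v => [|i v IH|c v w IHv IHw].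
- by rewrite vacuum_coef1 pairing_vac.
- rewrite vacuum_coefM vacuum_coef_creator mul0r -aL_creator -pairing_aR.
  by rewrite aR_vac /pairing big1 // => m _; rewrite mulr0 mul0r.
- by rewrite pairing_linear IHv IHw vacuum_coefD vacuum_coefZ.
Qed.

Lemma newton_vacuum_coef (p h : nat -> fock F) : newton p h ->
  newton (fun i => vacuum_coef (p i)) (fun m => vacuum_coef (h m)).
Proof. exact: (@newton_rmorph (fock F) F vacuum_coef p h). Qed.

Lemma vacuum_coef_f m : vacuum_coef (int_ext f m) = int_ext (h_nat x) m.
Proof.
case: m => [m|m] /=; last exact: rmorph0.
move: m; apply: newton_uniq; last exact: newton_h_pm.
  exact: (@torsion_free_alg F F^o).
apply: (newton_ext (newton_vacuum_coef newton_f) _ (fun=> erefl)) => i.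
by rewrite vacuum_coefD vacuum_coefZ vacuum_coef_creator vacuum_coef1 add0r mulr1.
Qed.

(** The parts of mu are removed one at a time, the outermost operator W^* of
    the bra being the one of the first part. *)
Lemma pairing_bra (mu : seq nat) n r q (m : 'I_n -> int) : (r + size mu <= n)%N ->
  pairing (bra mu) (bra_det iota f r q m) =
  \det (\matrix_(i < n, j < n)
    if (j < r)%N then q i j else
    if (j < r + size mu)%N then int_ext (h_nat x) (m i + j.+1%:Z - (nth 0%N mu (j - r))%:Z)
    else o_entry (int_ext (h_nat x)) (m i + (r + size mu)%N%:Z) (j - (r + size mu))%N.+1%:Z).
Proof.
elim: mu r q => [|k mu IH] r q rn.
  rewrite vacuum_coefE /bra_det -det_map_mx; congr (\det _); apply/matrixP => i j.
  rewrite !mxE addn0; case: ifP => _.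
    by rewrite /= vacuum_coefZ vacuum_coef1 mulr1.
  by rewrite /o_entry rmorphB /= !vacuum_coef_f.
rewrite -[bra _]/(Wstar (- k%:Z) (bra mu)) pairing_Wstar //.
rewrite -[laurent _ _ _]/(laurent_mul (- 1) (- k%:Z) (laurent_eval 1 _)).
rewrite (@bra_det_step _ _ iota (laurent_eval (1 : F)) (creation_series (- 1)) f
  (h_nat x) (laurent_mul (- 1))).
- rewrite IH; last by rewrite addSnnS.
  congr (\det _); apply/matrixP => i j; rewrite !mxE /= addSnnS ltnS.
  case: (ltngtP j r) => [jr|rj|jr].
  + by [].
  + by rewrite -(subnSK rj).
  + rewrite jr subnn /= ifT; last lia.
    by [].
- exact: laurent_eval_f.
- exact: laurent_eval_const.
- exact: conv_ef.
- exact: laurent_mulD.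
- exact: laurent_mul0.
- exact: laurent_mulM.
- exact: laurent_mulX.
- exact: laurent_mul1.
- by rewrite /= in rn; lia.
Qed.

End Skew.
End MainProof.

Theorem proposition3p8 (F : fieldType) (charF0 : [pchar F] =i pred0)
    (l N : nat) (N_gt0 : (0 < N)%N)
    (mu : l.-tuple nat) (lam : (l + N).-tuple nat)
    (mu_part : sorted geq mu) (lam_part : sorted geq lam)
    (x : 'I_N -> F) (x_neq0 : forall i, x i != 0) :
  pairing (bra mu) (Gamma_plus_pm x (ket lam)) = \det (b_mx x mu lam).
Proof.
have F0 := char0P charF0.
pose f m := shift_eval (power_sum_pm x) (creation_series 1 m).
pose m (i : 'I_(l + N)) : int := (tnth lam i)%:Z - i.+1%:Z.
have -> : Gamma_plus_pm x (ket lam) = bra_det (in_alg (fock F)) f 0 (fun _ _ => 0) m.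
  rewrite ket_as_det // Gamma_plus_pmE // /ket_det size_tuple -det_map_mx.
  congr (\det _); apply/matrixP => i j; rewrite !mxE /= addr0 subn0.
  rewrite /o_entry rmorphB /= !(int_ext_morph _ _ (rmorph0 (shift_eval _))).
  by rewrite /m (tnth_nth 0%N).
rewrite pairing_bra ?size_tuple ?leq_addr //; congr (\det _).
apply/matrixP => i j; rewrite !mxE add0n subn0.
case: splitP => [j' jE|j' jE]; rewrite jE.
  rewrite ltn0 h_pm_int /m (tnth_nth 0%N mu); congr (int_ext _ _); lia.
rewrite ltn0 addKn /o_entry !h_pm_int /m.
by congr (int_ext _ _ - int_ext _ _); lia.
Qed.
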